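(* (1) Let $0<u\le\sqrt3$. Then $\widetilde P^u$ has no atoms. (2) Let $u>\sqrt3$. Then $\widetilde P^u(\{x\})>0$ for any $x\in D\cap(0,1]$, where $D$ is the set of dyadic rationals in $[0,1]$.
   Context: Let $x_u=\frac{2}{1+\sqrt{1+8u^2}}$ for $u\ge0$. Paths. For $n\ge 0$ let $W(n)$ be the set of $(\omega(0),\dots,\omega(n))\in\mathbb Z^{n+1}$ with $\omega(0)=0$ and $|\omega(i)-\omega(i+1)|=1$ for $0\le i\le n-1$; let $W^*=\bigcup_{n\ge 0}W(n)$ and $L(\omega)=n$ for $\omega\in W(n)$. For $\omega\in W^*$ and integers $M\ge 0$, let $T_0^M(\omega)=0$ and, for $i\ge 1$, $T_i^M(\omega)=\min\{j>T_{i-1}^M(\omega):\omega(j)\in 2^M\mathbb Z\setminus\{\omega(T_{i-1}^M(\omega))\}\}$, with value $+\infty$ if the minimum does not exist. Let $(2^{-M}Q_M\omega)(i)=2^{-M}\omega(T_i^M(\omega))$ for all $i$ with $T_i^M(\omega)<\infty$; this is an element of $W^*$. Let $W_{N,\pm}=\{\omega\in W^*: L(\omega)=T_1^N(\omega),\ \omega(T_1^N(\omega))=\pm 2^N\}$. Measures. For $\omega\in W_{1,+}$ let $P^u_{1,+}(\{\omega\})=u^{L(\omega)-2}x_u^{L(\omega)-1}$ (with $0^0=1$, and $0^n=0$ for $n\geq 1$). Inductively, for $N\ge1$ and $\omega\in W_{N+1,+}$, let $\omega'=2^{-N}Q_N\omega\in W_{1,+}$ and, for $1\le j\le L(\omega')$,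 let $\widetilde\omega_j\in W_{N,+}$ be the path obtained from the segment $(\omega(T^N_{j-1}(\omega)+i)-\omega(T^N_{j-1}(\omega)))_{0\le i\le T^N_j(\omega)-T^N_{j-1}(\omega)}$ by multiplying it by the sign of $\omega(T_j^N(\omega))-\omega(T_{j-1}^N(\omega))$; set $P^u_{N+1,+}(\{\omega\})=P^u_{1,+}(\{\omega'\})\prod_{j=1}^{L(\omega')}P^u_{N,+}(\{\widetilde\omega_j\})$. Each $P^u_{N,+}$ is a probability measure on $W_{N,+}$. Let $P^u_{N,-}(\{\omega\})=P^u_{N,+}(\{-\omega\})$ for $\omega\in W_{N,-}$. Let $W_\infty$ be the set of infinite paths $(\omega(0),\omega(1),\dots)$ in $\mathbb Z$ with $\omega(0)=0$ and $|\omega(i)-\omega(i+1)|=1$ for all $i\ge0$, with the $\sigma$-algebra generated by cylinder sets. $P^u$ is the probability measure on $W_\infty$ (known to exist) such that for all $N\ge1$ and $\widetilde\omega\in W_{N,+}$ (resp. $W_{N,-}$), $P^u(\{\omega\in W_\infty:\omega(j)=\widetilde\omega(j),\ 0\le j\le L(\widetilde\omega)\})=\frac12P^u_{N,+}(\{\widetilde\omega\})$ (resp. $\frac12P^u_{N,-}(\{\widetilde\omega\})$). Range and limit. For $n\ge1$ and $\omega\in W_\infty$, $R_n(\omega)$ is the number of points of $\mathbb Z$ that $\omega$ visits before it hits the set $\{2^n,-2^n\}$. Under $P^u$ the random variables $R_n/2^n-1$ converge weakly as $n\to\infty$; $\widetilde P^u$ denotes the limiting probability measure on $[0,1]$. 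*)

(* Defs.v *)
From HB Require Import structures.
From mathcomp Require Import all_boot all_order all_algebra.
From mathcomp Require Import finmap.
From mathcomp Require Import all_classical all_reals all_analysis.

Set Implicit Arguments.
Unset Strict Implicit.
Unset Printing Implicit Defensive.

Import Order.TTheory GRing.Theory Num.Theory.
Import numFieldNormedType.Exports.

Local Open Scope classical_set_scope.
Local Open Scope ring_scope.

Definition unit_step (a b : int) : bool := `|a - b| == 1.

(* The path (w(0), ..., w(n)) of W^* is the sequence [:: w(0); ...; w(n)], so
   that w(i) is s`_i and L(w) is the size minus one. *)
Definition finite_path (s : seq int) : bool :=
  (ohead s == Some 0) && sorted unit_step s.

Definition path_length (s : seq int) : nat := (size s).-1.

(* [hit M s i] is T_i^M(s), with [None] standing for +oo. *)
Fixpoint hit (M : nat) (s : seq int) (i : nat) : option nat :=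
  if i is i'.+1 then
    if hit M s i' is Some t then
      ohead [seq j <- iota t.+1 (path_length s - t)
            | (2 ^+ M %| s`_j)%Z && (s`_j != s`_t)]
    else None
  else Some 0%N.

(* 2^{-M} Q_M; since T_i^M(s) >= i, the finite T_i^M(s) all have an index
   i <= L(s). *)
Definition decimate (M : nat) (s : seq int) : seq int :=
  [seq (s`_t %/ 2 ^+ M)%Z | t <- pmap (hit M s) (iota 0 (size s))].

Definition W_plus (N : nat) (s : seq int) : bool :=
  [&& finite_path s, hit N s 1 == Some (path_length s)
    & s`_(path_length s) == 2 ^+ N].

Definition W_minus (N : nat) (s : seq int) : bool :=
  [&& finite_path s, hit N s 1 == Some (path_length s)
    & s`_(path_length s) == - 2 ^+ N].

Definition path_opp (s : seq int) : seq int := [seq - a | a <- s].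

(* The piece of s between T_{j-1}^N(s) and T_j^N(s), translated to start at 0
   and reflected so as to end at 2^N; meaningful when 1 <= j and T_j^N(s) is
   finite. *)
Definition segment (N : nat) (s : seq int) (j : nat) : seq int :=
  let a := odflt 0%N (hit N s j.-1) in
  let b := odflt 0%N (hit N s j) in
  [seq Num.sg (s`_b - s`_a) * (s`_(a + i) - s`_a) | i <- iota 0 (b - a).+1].

Section Masses.
Variables (R : realType) (u : R).

Definition x_of : R := 2 / (1 + Num.sqrt (1 + 8 * u ^+ 2)).

(* Paths of W_{1,+} have length at least 2, so the subtractions are exact. *)
Definition mass1 (s : seq int) : R :=
  u ^+ (path_length s - 2) * x_of ^+ (path_length s - 1).

(* [mass_plus N s] is P^u_{N,+}({s}) for N >= 1 and s in W_{N,+}; the other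
   values carry no meaning. *)
Fixpoint mass_plus (N : nat) (s : seq int) : R :=
  match N with
  | 0%N => 0
  | N'.+1 =>
      match N' with
      | 0%N => mass1 s
      | _.+1 => let s' := decimate N' s in
          mass1 s' *
          \prod_(1 <= j < (path_length s').+1) mass_plus N' (segment N' s j)
      end
  end.

Definition mass_minus (N : nat) (s : seq int) : R := mass_plus N (path_opp s).

End Masses.

Record infinite_path := InfinitePath {
  at_time :> nat -> int;
  at_time0 : at_time 0%N = 0;
  at_timeS : forall i, `|at_time i - at_time i.+1| = 1 }.

Lemma straight_step (i : nat) : `|i%:Z - i.+1%:Z| = 1.
Proof. by rewrite -addn1 PoszD opprD addNKr normrN1. Qed.

HB.instance Definition _ := gen_eqMixin infinite_path.
HB.instance Definition _ := gen_choiceMixin infinite_path.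
HB.instance Definition _ :=
  isPointed.Build infinite_path (@InfinitePath Posz erefl straight_step).

Definition cylinder (s : seq int) : set infinite_path :=
  [set w | forall j, (j < size s)%N -> at_time w j = s`_j].

Definition cylinders : set (set infinite_path) :=
  [set cylinder s | s in [set s | finite_path s]].

Definition W_infty : measurableType _ := g_sigma_algebraType cylinders.

Section Limit.
Variables (R : realType).

(* P is P^u: its values on these cylinders, for all N, determine it. *)
Definition is_path_measure (u : R) (P : probability W_infty R) : Prop :=
  forall N s, (1 <= N)%N ->
    (W_plus N s -> P (cylinder s) = (2^-1 * mass_plus u N s)%:E) /\
    (W_minus N s -> P (cylinder s) = (2^-1 * mass_minus u N s)%:E).

(* The points visited strictly before the first visit to {2^n, -2^n}; they all
   lie in ]-2^n, 2^n[, so this set is finite for every path, including those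
   that never visit {2^n, -2^n}. *)
Definition visited_before (n : nat) (w : infinite_path) : set int :=
  [set k | exists2 j, at_time w j = k &
             forall i, (i <= j)%N -> at_time w i <> 2 ^+ n /\
                                     at_time w i <> - 2 ^+ n].

Definition range_size (n : nat) (w : infinite_path) : nat :=
  #|` fset_set (visited_before n w)|%fset.

Definition scaled_range (n : nat) (w : W_infty) : R :=
  (range_size n w)%:R / 2 ^+ n - 1.

Definition cvg_weakly d (T : measurableType d) (P : probability T R)
    (X : nat -> T -> R) (Q : probability (measurableTypeR R) R) : Prop :=
  forall f : R -> R, continuous f -> bounded_fun f ->
    (\int[P]_t (f (X n t))%:E)%E @[n --> \oo] --> (\int[Q]_x (f x)%:E)%E.

(* A probability measure on [0, 1] is seen as one on R that gives [0, 1] full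
   mass. *)
Definition is_limit_law (P : probability W_infty R)
    (Q : probability (measurableTypeR R) R) : Prop :=
  Q `[0, 1]%classic = 1%E /\ cvg_weakly P scaled_range Q.

Definition dyadic01 : set R :=
  [set x | 0 <= x <= 1 /\ exists (k : int) (m : nat), x = k%:~R / 2 ^+ m].

End Limit.

(* Main.v *)
Require Import Defs.
From HB Require Import structures.
From mathcomp Require Import all_boot all_order all_algebra.
From mathcomp Require Import finmap zify ring lra.
From mathcomp Require Import all_classical all_reals all_analysis.
From mathcomp Require Import measurable_realfun.
Import Order.TTheory GRing.Theory Num.Theory.
Import numFieldNormedType.Exports.
Local Open Scope classical_set_scope.
Local Open Scope ring_scope.

(** A walk that crosses from 0 to 2^(N+1) is, at scale 2^N, a sequence of
    excursions 0 -> 1 -> 0 or 0 -> -1 -> 0 followed by 0 -> 1 -> 2.  Write [a]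
    for the mass [u ^+ 2 * x_of u ^+ 2] of one excursion on a given side; the
    choice of [x_of u] is the normalization [x_of u = 1 - 2 * a].  Every step
    of this coarse walk is refined by an independent crossing of scale 2^N.
    On a path that ends at 2^N the number of visited points is 2^N plus the
    depth, the distance of the minimum from 0, so the limit law is that of
    depth / 2^N.

    The depth at scale 2^(N+1) stays below m <= 2^N when all excursions go to
    the right and every crossing that starts from 0 stays above -m; it stays
    below 2^N + m when the second half of each left excursion, which runs from
    -2^N back to 0, stays above -2^N - m.  Summing geometric series, the
    distribution function of the depth satisfies the de Rham recursion
    F_(N+1)(m) = f0 (F_N(m)) and F_(N+1)(2^N + m) = f1 (F_N(m)), with
    f0(p) = (1 - 2a) p / (1 - a p) and f1(p) = (1 - 2a) / (1 - a - a p)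
    ([esum_shallow]).  In particular the values of F_N at the multiples of
    2^(N-l) do not depend on N >= l ([depth_cdf_refine]): the mass that
    every level N >= l gives to a dyadic interval [j / 2^l, (j + 1) / 2^l[ is
    the length of the interval f_w([0, 1]), for a word w of length l in f0
    and f1.

    The map f1 fixes 1 with slope a / (1 - 2a) there, and u = sqrt 3 is the
    value at which this slope is 1.  If u <= sqrt 3, both maps send an
    interval of length D to one of length at most D / (1 + a D), also in the
    parabolic case u = sqrt 3; hence all the intervals f_w([0, 1]) with w of
    length l have length at most 1 / (1 + a l), and there are no atoms
    ([depth_cdf_gap], [point_mass_le]).  If u > sqrt 3, then (1 - 2a) / a < 1
    is another fixed point of f1, no F_N exceeds it at the last point before
    1, and this leaves an atom at 1; the two maps copy it to every dyadic
    rational in ]0, 1] ([depth_cdf_jump], [dyadic_mass_ge]).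

    The masses are handled through a countable type [itinerary N] that codes
    the crossings as nested sequences of excursions.  The paths of this code
    already carry total mass 1 ([esum_weight]), so that lower bounds on integrals
    over disjoint unions of cylinders suffice ([integral_ge_esum],
    [limit_law_ge]): an upper bound on a mass is a lower bound on the mass of
    the complement. *)

Set Implicit Arguments.
Unset Strict Implicit.
Unset Printing Implicit Defensive.

(** * Gluing crossings together *)

Definition orient (b : bool) : int := if b then 1 else -1.

(** The part before the end point of a path that starts at 0 and leaves
    ]-h, h[ at h.  Leaving the last point out makes concatenation of crossings
    plain concatenation of sequences. *)
Definition crossing (h : int) (s : seq int) : bool :=
  [&& ohead s == Some 0, all (fun v => `|v| < h) s
    & sorted unit_step (rcons s h)].

(** In a list of pieces [(b, s)], [s] is a crossing and [b] tells whether it is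
    run upwards or reflected; each piece starts where the preceding one
    ended, at a multiple of [h] away from [a]. *)
Fixpoint weave (h a : int) (l : seq (bool * seq int)) : seq int :=
  if l is (b, s) :: l' then
    [seq a + orient b * v | v <- s] ++ weave h (a + orient b * h) l'
  else [::].

Definition corner (h a : int) (l : seq (bool * seq int)) : int :=
  a + h * \sum_(p <- l) orient p.1.

Definition woven (h a : int) (l : seq (bool * seq int)) : seq int :=
  rcons (weave h a l) (corner h a l).

Definition duration (l : seq (bool * seq int)) : nat :=
  \sum_(p <- l) size p.2.

Lemma ohead_filter_iota (p : pred nat) (m n k : nat) :
  (m <= k < m + n)%N -> p k -> (forall i, (m <= i < k)%N -> ~~ p i) ->
  ohead [seq i <- iota m n | p i] = Some k.
Proof.
move=> /andP[mk kn] pk npi.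
have -> : n = ((k - m) + (m + n - k.+1).+1)%N by lia.
rewrite iotaD filter_cat subnKC //= pk.
rewrite (_ : [seq i <- iota m (k - m) | p i] = [::]) //; apply/eqP.
rewrite -[_ == _]negbK -has_filter; apply/hasPn => i.
by rewrite mem_iota subnKC // => /npi.
Qed.

Lemma small_multiple_eq0 (h v : int) : `|v| < h -> (h %| v)%Z = (v == 0).
Proof.
move=> vh; apply/idP/eqP => [|->]; last exact: dvdz0.
rewrite /dvdz /= => hv.
case: (posnP `|v|%N) => [|v0]; first by lia.
by have := dvdn_leq v0 hv; lia.
Qed.

Lemma crossing_gt0 h s : crossing h s -> 0 < h.
Proof. by case: s => [|v s] // /and3P[/eqP[->]] /= /andP[]; rewrite normr0. Qed.

Lemma crossing_size h s : crossing h s -> (0 < size s)%N.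
Proof. by case: s => [|v s] // /and3P[]. Qed.

Lemma crossing0 h s : crossing h s -> s`_0 = 0.
Proof. by case: s => [|v s] // /and3P[/eqP[->]]. Qed.

Lemma crossing_lt h s i : crossing h s -> (i < size s)%N -> `|s`_i| < h.
Proof. by move=> /and3P[_ /allP hs _] si; apply: hs; apply: mem_nth. Qed.

Lemma woven_cons h a b s l :
  woven h a ((b, s) :: l) =
  [seq a + orient b * v | v <- s] ++ woven h (a + orient b * h) l.
Proof.
rewrite /woven /= rcons_cat /corner big_cons /= mulrDr addrA.
by rewrite [orient b * h]mulrC.
Qed.

(** The head is [a] also when there are no pieces, as the end point is then
    [a]; this is what makes consecutive pieces match. *)
Lemma woven_head h a l : all (fun p => crossing h p.2) l ->
  ohead (woven h a l) = Some a.
Proof.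
case: l => [|[b s] l] /=; first by rewrite /woven /corner /= big_nil mulr0 addr0.
rewrite woven_cons => /andP[/= + _]; case: s => [|v s] //= /and3P[/eqP[->] _ _].
by rewrite mulr0 addr0.
Qed.

Lemma sorted_orient b a s :
  sorted unit_step [seq a + orient b * v | v <- s] = sorted unit_step s.
Proof.
case: s => //= v s; elim: s v => //= w s IH v; rewrite IH; congr (_ && _).
rewrite /unit_step opprD addrACA subrr add0r -mulrBr normrM.
by case: (b); rewrite /= ?normr1 ?normrN1 mul1r.
Qed.

Lemma sorted_cat_head (T : eqType) (e : rel T) (s t : seq T) y :
  ohead t = Some y -> sorted e (s ++ t) = sorted e (rcons s y) && sorted e t.
Proof.
case: t => [|z t] //= [->]; case: s => [|x s] //=.
by rewrite cat_path /= rcons_path andbA.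
Qed.

Lemma woven_sorted h a l : all (fun p => crossing h p.2) l ->
  sorted unit_step (woven h a l).
Proof.
elim: l a => [|[b s] l IH] a //= /andP[/= hs hl].
rewrite woven_cons (sorted_cat_head _ _ (woven_head _ hl)) IH // andbT.
have -> : rcons [seq a + orient b * v | v <- s] (a + orient b * h) =
          [seq a + orient b * v | v <- rcons s h] by rewrite map_rcons.
by rewrite sorted_orient; case/and3P: hs.
Qed.

Lemma size_weave h a l : size (weave h a l) = duration l.
Proof.
rewrite /duration; elim: l a => [|[b s] l IH] a /=; first by rewrite big_nil.
by rewrite size_cat size_map IH big_cons.
Qed.

Lemma size_woven h a l : size (woven h a l) = (duration l).+1.
Proof. by rewrite size_rcons size_weave. Qed.

Lemma woven_nth h a l j i (hl : all (fun p => crossing h p.2) l)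
    (p := nth (true, [::]) l j) :
  (j < size l)%N -> (i <= size p.2)%N ->
  (woven h a l)`_(duration (take j l) + i) =
    corner h a (take j l) + orient p.1 * (rcons p.2 h)`_i.
Proof.
rewrite {}/p; elim: l a j hl => [|[b s] l IH] a j //= /andP[/= hs hl].
rewrite woven_cons nth_cat size_map.
case: j => [|j] /= => [_|] si; rewrite /duration /corner.
  rewrite !big_nil mulr0 addr0 add0n nth_rcons.
  have [lt_is|] := ltnP i (size s); first by rewrite (nth_map 0).
  move=> le_si; have -> : i = size s by apply/eqP; rewrite eqn_leq si.
  rewrite eqxx subnn.
  by have := woven_head (a + orient b * h) hl; case: woven => // ? ? [].
move=> ip; rewrite !big_cons /= ltnNge -addnA leq_addr /= addKn.
by rewrite IH // /corner mulrDr addrA [orient b * h]mulrC.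
Qed.

Lemma duration_take_lt l j : (j < size l)%N ->
  duration (take j.+1 l) =
    (duration (take j l) + size (nth (true, [::]) l j).2)%N.
Proof.
by move=> jl; rewrite (take_nth (true, [::])) // /duration -cats1 big_cat big_seq1.
Qed.

Lemma duration_take_le l j : (duration (take j l) <= duration l)%N.
Proof.
by rewrite -{2}(cat_take_drop j l) /duration big_cat /= leq_addr.
Qed.

Lemma woven_corner h a l j : all (fun p => crossing h p.2) l ->
  (j <= size l)%N ->
  (woven h a l)`_(duration (take j l)) = corner h a (take j l).
Proof.
move=> hl; rewrite leq_eqVlt => /orP[/eqP->|jl].
  by rewrite take_size /woven nth_rcons size_weave ltnn eqxx.
rewrite -[duration _]addn0 (woven_nth a hl jl) //.
have /allP/(_ _ (mem_nth (true, [::]) jl)) /= hp := hl.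
by rewrite nth_rcons (crossing_size hp) (crossing0 hp) mulr0 addr0.
Qed.

Lemma cornerS h a l j : (j < size l)%N ->
  corner h a (take j.+1 l) =
    corner h a (take j l) + orient (nth (true, [::]) l j).1 * h.
Proof.
move=> jl; rewrite (take_nth (true, [::])) // /corner -cats1 big_cat big_seq1.
by rewrite /= mulrDr addrA [h * orient _]mulrC.
Qed.

(** Inside a piece the path is at distance less than 2^N from the multiple of
    2^N where the piece started, so it meets no other multiple before the end
    of the piece. *)
Lemma hit_woven N l j (h := 2 ^+ N : int) :
  all (fun p => crossing h p.2) l -> (j <= size l)%N ->
  hit N (woven h 0 l) j = Some (duration (take j l)).
Proof.
rewrite /h => hl; elim: j => [|j IH] jl.
  by rewrite /= take0 /duration big_nil.
rewrite /= IH; last exact: ltnW.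
rewrite (woven_corner _ hl (ltnW jl)).
have /allP/(_ _ (mem_nth (true, [::]) jl)) /= hp := hl.
have eqd := duration_take_lt jl.
have s0 := crossing_size hp.
have hn0 : (2 ^+ N : int) != 0 by rewrite expf_neq0.
have hc : (2 ^+ N %| corner (2 ^+ N) 0 (take j l))%Z.
  by rewrite /corner add0r dvdz_mulr.
apply: ohead_filter_iota.
- rewrite eqd /path_length size_woven /=.
  by have := duration_take_le l j.+1; rewrite eqd; lia.
- rewrite (woven_corner _ hl jl) cornerS //; apply/andP; split.
    by rewrite rpredDl ?dvdz_mull.
  rewrite -subr_eq0 [_ + _ - _]addrAC subrr add0r mulf_neq0 //.
  by case: (_.1).
move=> k /andP[lk]; rewrite eqd => kl.
have -> : k = (duration (take j l) + (k - duration (take j l)))%N by lia.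
rewrite (woven_nth _ hl jl); last by lia.
rewrite nth_rcons ifT; last by rewrite ltn_psubLR.
set i := (_ - _)%N; have hi := crossing_lt (i := i) hp.
have {}hi : `|(nth (true, [::]) l j).2`_i| < 2 ^+ N by apply: hi; rewrite ltn_psubLR.
rewrite rpredDl // small_multiple_eq0; last first.
  by rewrite normrM; case: (_.1); rewrite /= ?normrN1 ?normr1 mul1r.
rewrite mulf_eq0 (_ : (orient _ == 0) = false) /=; last by case: (_.1).
by apply/negP => /andP[/eqP ->]; rewrite mulr0 addr0 eqxx.
Qed.

Lemma hit_woven_None N l j (h := 2 ^+ N : int) :
  all (fun p => crossing h p.2) l -> (size l < j)%N ->
  hit N (woven h 0 l) j = None.
Proof.
move=> hl; elim: j => // j IH; rewrite ltnS leq_eqVlt => /orP[/eqP<-|lj] /=.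
  rewrite hit_woven // take_size /path_length size_woven /= subnn //=.
by rewrite IH.
Qed.

Lemma crossing_W_plus N s : crossing (2 ^+ N) s -> W_plus N (rcons s (2 ^+ N)).
Proof.
move=> hs; have : woven (2 ^+ N) 0 [:: (true, s)] = rcons s (2 ^+ N).
  rewrite /woven /= cats0 /corner big_seq1 /= mulr1 add0r.
  by congr rcons; rewrite -[RHS]map_id; apply: eq_map => v; rewrite add0r mul1r.
have hl : all (fun p => crossing (2 ^+ N) p.2) [:: (true, s)] by rewrite /= hs.
move=> eqs; rewrite /W_plus /finite_path -eqs (woven_head 0 hl) woven_sorted //.
rewrite hit_woven // eqs /path_length size_rcons /= nth_rcons ltnn !eqxx.
by rewrite /duration big_seq1 /= eqxx.
Qed.

Lemma size_decimate_woven N l (h := 2 ^+ N : int) :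
  all (fun p => crossing h p.2) l ->
  size (decimate N (woven h 0 l)) = (size l).+1.
Proof.
rewrite /h => hl; rewrite /decimate size_map size_pmap size_woven.
have sl : (size l <= duration l)%N.
  rewrite /duration -(sum1_size l) big_seq [leqRHS]big_seq; apply: leq_sum => p pl.
  by have /allP/(_ _ pl) := hl; exact: crossing_size.
have -> : (duration l).+1 = ((size l).+1 + (duration l - size l))%N by lia.
rewrite iotaD count_cat [X in (X + _)%N](_ : _ = size (iota 0 (size l).+1)).
  rewrite size_iota [X in (_ + X)%N](_ : _ = 0)%N ?addn0 //.
  apply/eqP; rewrite -leqn0 leqNgt -has_count; apply/hasPn => j.
  by rewrite mem_iota add0n => /andP[lj _]; rewrite /= hit_woven_None.
apply/eqP; rewrite -all_count; apply/allP => j.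
by rewrite mem_iota add0n => /andP[_ jl]; rewrite /= hit_woven.
Qed.

Lemma sg_orient b (h : int) : 0 < h -> Num.sg (orient b * h) = orient b.
Proof. by move=> h0; rewrite sgrM (gtr0_sg h0) mulr1; case: b. Qed.

Lemma orientK b (v : int) : orient b * (orient b * v) = v.
Proof. by case: b => /=; lia. Qed.

Lemma segment_woven N l j (h := 2 ^+ N : int) :
  all (fun p => crossing h p.2) l -> (j < size l)%N ->
  segment N (woven h 0 l) j.+1 = rcons (nth (true, [::]) l j).2 h.
Proof.
rewrite /h => hl jl; have jl' := ltnW jl.
rewrite /segment succnK (hit_woven hl jl) (hit_woven hl jl') ![odflt _ _]/=.
rewrite (woven_corner _ hl jl) (woven_corner _ hl jl').
have /allP/(_ _ (mem_nth (true, [::]) jl)) hp := hl.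
rewrite cornerS // [_ + _ - _]addrAC subrr add0r sg_orient; last exact: crossing_gt0 hp.
rewrite duration_take_lt // addKn -[RHS](mkseq_nth (0 : int)) size_rcons /mkseq.
apply/eq_in_map => i; rewrite mem_iota add0n => /andP[_ il].
by rewrite (woven_nth _ hl jl) // [_ + _ - _]addrAC subrr add0r orientK.
Qed.

(** The left inverse of weaving; that weaving loses no information is what
    keeps the coded paths distinct. *)
Definition unweave (N : nat) (w : seq int) : seq (bool * seq int) :=
  let T j := odflt 0%N (hit N w j) in
  [seq (w`_(T j) < w`_(T j.+1),
        take (T j.+1 - T j) (segment N w j.+1))
  | j <- iota 0 (size (decimate N w)).-1].

Lemma wovenK N l (h := 2 ^+ N : int) :
  all (fun p => crossing h p.2) l -> unweave N (woven h 0 l) = l.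
Proof.
rewrite /h => hl; rewrite /unweave size_decimate_woven //.
rewrite -[RHS](mkseq_nth (true, [::])) /mkseq.
apply/eq_in_map => j; rewrite mem_iota add0n => /andP[_ jl].
have /allP/(_ _ (mem_nth (true, [::]) jl)) hp := hl.
rewrite segment_woven // !hit_woven //; last exact: ltnW.
rewrite /= !woven_corner //; last exact: ltnW.
rewrite cornerS // duration_take_lt // addKn -cats1 take_size_cat //.
have := crossing_gt0 hp; case: (nth _ _ _) => [[] s] /= h0; congr pair; lia.
Qed.

(** A walk on the coarse lattice from 0 to 2 that stops there: a list of
    excursions from 0, each with its side ([true] for the right) and data for
    its outward and its return step, then the data for 0 -> 1 and 1 -> 2. *)
Definition excursions (T : Type) : Type := (seq (bool * (T * T)) * (T * T))%type.

Definition turns (T : Type) (f : T -> seq int) (c : excursions T) :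
    seq (bool * seq int) :=
  flatten [seq [:: (x.1, f x.2.1); (~~ x.1, f x.2.2)] | x <- c.1] ++
  [:: (true, f c.2.1); (true, f c.2.2)].

(** At level 0 a crossing is the single step 0 -> 1. *)
Fixpoint itinerary (N : nat) : countType :=
  if N is N'.+1 then
    (seq (bool * (itinerary N' * itinerary N')) * (itinerary N' * itinerary N'))%type
  else unit.

Fixpoint body (N : nat) : itinerary N -> seq int :=
  match N with
  | 0%N => fun _ => [:: 0]
  | N'.+1 => fun c => weave (2 ^+ N') 0 (turns (@body N') c)
  end.

Section Turns.
Variables (T : Type) (f : T -> seq int) (h : int).
Implicit Type c : excursions T.

Lemma all_turns (a : pred (seq int)) c : (forall t, a (f t)) ->
  all (fun p => a p.2) (turns f c).
Proof.
move=> af; rewrite /turns all_cat /= !af !andbT.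
by elim: c.1 => //= x l ->; rewrite !af.
Qed.

Lemma sum_orient_turns c : \sum_(p <- turns f c) orient p.1 = 2.
Proof.
rewrite /turns big_cat /= big_cons big_seq1.
elim: c.1 => [|x l IH] /=; first by rewrite big_nil.
by rewrite !big_cons -!addrA addrA IH; case: x => [[] ?].
Qed.

Lemma size_turns c : size (turns f c) = (size c.1).*2.+2.
Proof.
rewrite /turns size_cat addn2; congr _.+2.
by elim: c.1 => //= x l ->.
Qed.

(** The return step of an excursion starts at distance [h] from 0 and comes
    back, whence the values [orient x.1 * (h - v)]. *)
Lemma all_weave_turns (P : pred int) c :
  all P (weave h 0 (turns f c)) =
  all (fun x => all (fun v => P (orient x.1 * v)) (f x.2.1) &&
                all (fun v => P (orient x.1 * (h - v))) (f x.2.2)) c.1 &&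
  (all P (f c.2.1) && all (fun v => P (h + v)) (f c.2.2)).
Proof.
case: c => l [t1 t2]; rewrite /turns /=; elim: l => [|[b [c1 c2]] l IH] /=.
  rewrite cats0 all_cat !all_map; congr (_ && _); apply: eq_all => v /=.
    by rewrite add0r mul1r.
  by rewrite add0r !mul1r.
rewrite !all_cat !all_map (_ : 0 + _ + _ = 0) ?IH; last by case: b => /=; lia.
rewrite -!andbA; congr [&& _, _ & _]; apply: eq_all => v /=; first by rewrite add0r.
by congr P; case: b => /=; lia.
Qed.

Lemma turns_inj (f_inj : injective f) : injective (turns f).
Proof.
move=> [l [t1 t2]] [l' [t1' t2']]; rewrite /turns /=.
elim: l l' => [|[b [c1 c2]] l IH] [|[b' [c1' c2']] l'] /=.
- by move=> [/f_inj -> /f_inj ->].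
- by move=> /(congr1 size); rewrite /= size_cat /=; lia.
- by move=> /(congr1 size); rewrite /= size_cat /=; lia.
by move=> [-> /f_inj -> _ /f_inj -> /IH [-> -> ->]].
Qed.

End Turns.

Definition path_of N (c : itinerary N) : seq int := rcons (body c) (2 ^+ N).

Lemma path_ofS N (c : itinerary N.+1) :
  path_of c = woven (2 ^+ N) 0 (turns (@body N) c).
Proof.
by rewrite /path_of /woven /corner sum_orient_turns add0r exprSr.
Qed.

Lemma body_crossing N (c : itinerary N) : crossing (2 ^+ N) (body c).
Proof.
elim: N c => [|N IH] c; first by [].
have hl : all (fun p => crossing (2 ^+ N) p.2) (turns (@body N) c).
  exact: (all_turns c IH).
apply/and3P; split; last 1 first.
- by have := woven_sorted 0 hl; rewrite -path_ofS.
- have := woven_head 0 hl; rewrite -path_ofS /path_of.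
  have : (0 < size (body c))%N.
    rewrite /= size_weave /duration /turns big_cat /= big_cons.
    by rewrite !addn_gt0 (crossing_size (IH _)) orbT.
  by case: (body c) => [|v s] //= _ ->.
have small (t : itinerary N) v : v \in body t -> `|v| < 2 ^+ N.
  by move=> vt; have /and3P[_ /allP + _] := IH t; exact.
have far b (h v : int) : `|v| < h ->
    (`|orient b * v| < h * 2) /\ (`|orient b * (h - v)| < h * 2).
  by case: b; rewrite /orient; lia.
rewrite /= all_weave_turns exprSr; apply/andP; split.
  apply/allP => -[b [c1 c2]] _ /=; apply/andP.
  by split; apply/allP => v /small /(far b)[].
apply/andP; split; apply/allP => v /small; first by move=> /(far true)[]; rewrite mul1r.
by rewrite -normrN => /(far true)[_]; rewrite mul1r opprK.
Qed.

(** * Itineraries, their depth and their weight *)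

Lemma turns_crossing N (c : itinerary N.+1) :
  all (fun p => crossing (2 ^+ N) p.2) (turns (@body N) c).
Proof. exact: (all_turns c (@body_crossing N)). Qed.

(** By induction on the level: the pieces are recovered by [wovenK], and each
    of them determines its itinerary. *)
Lemma path_of_inj N : injective (@path_of N).
Proof.
elim: N => [[] []//|N IH] c c' eqcc'.
have body_inj : injective (@body N) by move=> d d' e; apply: IH; rewrite /path_of e.
apply: (turns_inj body_inj).
by rewrite -(wovenK (turns_crossing c)) -(wovenK (turns_crossing c')) -!path_ofS eqcc'.
Qed.

Lemma body_lt N (c : itinerary N) v : v \in body c -> `|v| < 2 ^+ N.
Proof. by move=> vc; have /and3P[_ /allP + _] := body_crossing c; exact. Qed.

Lemma body_0 N (c : itinerary N) : 0 \in body c.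
Proof.
have /and3P[+ _ _] := body_crossing c.
by case: (body c) => // v s /eqP[->]; rewrite mem_head.
Qed.

Lemma pow2Z N : 2 ^+ N = (2 ^ N)%:Z.
Proof. by elim: N => // N IH; rewrite exprS IH expnS PoszM. Qed.

(** The depth of the path is less than [m]. *)
Definition shallow N (m : nat) (c : itinerary N) : bool :=
  all (fun v => - m%:Z < v) (body c).

Lemma shallow0 N (c : itinerary N) : shallow 0 c = false.
Proof. by apply/negP => /allP/(_ _ (body_0 c)); rewrite oppr0. Qed.

Lemma shallow_max N m (c : itinerary N) : (2 ^ N <= m)%N -> shallow m c.
Proof. by move=> Nm; apply/allP => v /body_lt; rewrite pow2Z; lia. Qed.

(** A left excursion reaches -2^N, hence is excluded, and only the crossings
    that start from 0 can go below 0. *)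
Lemma shallow_near N m (c : itinerary N.+1) : (m <= 2 ^ N)%N ->
  shallow m c =
  all (fun x => x.1 && shallow m x.2.1) c.1 && shallow m c.2.1.
Proof.
move=> mN; have lt d v : v \in @body N d -> `|v| < (2 ^ N)%:Z.
  by move=> /body_lt; rewrite pow2Z.
rewrite /shallow /= all_weave_turns; congr (_ && _); last first.
  rewrite [X in _ && X](_ : _ = true) ?andbT //.
  by apply/allP => v /lt; rewrite pow2Z; lia.
apply: eq_all => -[[] [c1 c2]] /=.
  rewrite [X in _ && X](_ : _ = true); last first.
    by apply/allP => v /lt; rewrite pow2Z; lia.
  by rewrite andbT; apply: eq_all => v; rewrite mul1r.
apply/negP => /andP[_ /allP/(_ _ (body_0 _))]; rewrite pow2Z subr0; lia.
Qed.

(** Below -2^N the path is only seen on the return step of a left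
    excursion, which is a reflected crossing started from -2^N. *)
Lemma shallow_far N m (c : itinerary N.+1) :
  shallow (2 ^ N + m) c = all (fun x => x.1 || shallow m x.2.2) c.1.
Proof.
have lt d v : v \in @body N d -> `|v| < (2 ^ N)%:Z.
  by move=> /body_lt; rewrite pow2Z.
rewrite /shallow /= all_weave_turns [X in _ && X](_ : _ = true) ?andbT; last first.
  by apply/andP; split; apply/allP => v /lt; rewrite ?pow2Z; lia.
apply: eq_all => -[[] [c1 c2]] /=.
  by apply/andP; split; apply/allP => v /lt; rewrite ?pow2Z; lia.
rewrite [X in X && _](_ : _ = true) /=; last by apply/allP => v /lt; lia.
by apply: eq_all => v; rewrite pow2Z; lia.
Qed.

Section Weight.
Variables (R : realType) (u : R).

(** Two more steps of the coarse walk multiply its mass by this factor. *)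
Definition excursion_mass : R := u ^+ 2 * x_of u ^+ 2.

Fixpoint weight (N : nat) : itinerary N -> R :=
  match N with
  | 0%N => fun _ => 1
  | N'.+1 => fun c =>
      (\prod_(x <- c.1) (excursion_mass * (weight x.2.1 * weight x.2.2))) *
      (x_of u * (weight c.2.1 * weight c.2.2))
  end.

Lemma weightS N (c : itinerary N.+1) :
  weight c = (\prod_(x <- c.1)
    (excursion_mass * (weight x.2.1 * weight x.2.2))) *
    (x_of u * (weight c.2.1 * weight c.2.2)).
Proof. by []. Qed.

(** [mass1] only depends on the length, which [size_decimate_woven] gives. *)
Lemma mass_plus_woven N l (h := 2 ^+ N.+1 : int) :
  all (fun p => crossing h p.2) l ->
  mass_plus u N.+2 (woven h 0 l) =
    u ^+ (size l - 2) * x_of u ^+ (size l - 1) *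
    \prod_(p <- l) mass_plus u N.+1 (rcons p.2 h).
Proof.
rewrite /h => hl.
have -> : mass_plus u N.+2 (woven (2 ^+ N.+1) 0 l) =
  mass1 u (decimate N.+1 (woven (2 ^+ N.+1) 0 l)) *
  \prod_(1 <= j < (path_length (decimate N.+1 (woven (2 ^+ N.+1) 0 l))).+1)
    mass_plus u N.+1 (segment N.+1 (woven (2 ^+ N.+1) 0 l) j) by [].
rewrite /mass1 /path_length size_decimate_woven // succnK big_add1 succnK.
congr (_ * _); rewrite (big_nth (true, [::])) !big_mkord.
by apply: eq_bigr => j _; rewrite segment_woven.
Qed.

Lemma prod_turns (T : Type) (f : T -> seq int) (g : seq int -> R) c :
  \prod_(p <- turns f c) g p.2 =
    (\prod_(x <- c.1) (g (f x.2.1) * g (f x.2.2))) *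
    (g (f c.2.1) * g (f c.2.2)).
Proof.
rewrite /turns big_cat big_cons big_seq1 /=; congr (_ * _).
by elim: c.1 => [|x l IH] /=; rewrite ?big_nil // !big_cons IH mulrA.
Qed.

Lemma prodr_scale (T : Type) (e : R) (g : T -> R) (l : seq T) :
  \prod_(x <- l) (e * g x) = e ^+ size l * \prod_(x <- l) g x.
Proof.
by rewrite big_split big_const_seq count_predT iter_mulr mulr1.
Qed.

(** Two coarse steps for each excursion and two more for 0 -> 1 -> 2: the
    exponents [2k] of [u] and [2k+1] of [x_of u] split into one
    [excursion_mass] for each of the [k] excursions and one factor [x_of u]. *)
Lemma mass_plus_path_of N (c : itinerary N.+1) :
  mass_plus u N.+1 (path_of c) = weight c.
Proof.
elim: N c => [|N IH] c.
  rewrite /= /mass1 /path_length size_rcons size_weave /duration.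
  have -> : (\sum_(p <- turns (body (N:=0)) c) size p.2 = (size c.1).*2.+2)%N.
    by rewrite /turns big_cat /= big_cons big_seq1 /=; elim: c.1 => [|x l IH] /=;
       rewrite ?big_nil // !big_cons /= -!addnA IH.
  rewrite !mulr1; elim: c.1 => [|x l IH]; first by rewrite big_nil /= mul1r.
  rewrite big_cons -mulrA -IH /= !subSS !subn0 doubleS /excursion_mass.
  by rewrite !exprS; ring.
rewrite path_ofS mass_plus_woven ?turns_crossing // size_turns !subSS !subn0.
rewrite (prod_turns _ (fun s => mass_plus u N.+1 (rcons s (2 ^+ N.+1)))).
have IHb (d : itinerary N.+1) :
    mass_plus u N.+1 (rcons (body d) (2 ^+ N.+1)) = weight d by exact: IH.
rewrite !IHb; under eq_bigr do rewrite !IHb.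
have rearrange (U X x p q r : R) :
  U * (x * X) * (p * (q * r)) = U * X * p * (x * (q * r)) by ring.
rewrite (weightS c) prodr_scale -muln2 mulnC [x_of u ^+ _]exprS !exprM.
by rewrite (exprMn _ (u ^+ 2)) rearrange.
Qed.

End Weight.

(** * The recursion for the distribution of the depth *)

Section DepthLaw.
Variables (R : realType) (a : R).

(** The two branches of the de Rham recursion: the sum of
    [x p (a p)^k], respectively of [x (a + a p)^k], over k, with
    x = 1 - 2a. *)
Definition near_map (p : R) : R := (1 - 2 * a) * p / (1 - a * p).
Definition far_map (p : R) : R := (1 - 2 * a) / (1 - a - a * p).

Fixpoint depth_cdf (N m : nat) : R :=
  if N is N'.+1 then
    if (m <= 2 ^ N')%N then near_map (depth_cdf N' m)
    else far_map (depth_cdf N' (m - 2 ^ N'))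
  else (0 < m)%:R.

Lemma depth_cdf0 N : depth_cdf N 0 = 0.
Proof. by elim: N => //= N ->; rewrite /near_map mulr0 mul0r. Qed.

Lemma depth_cdf_near N m :
  (m <= 2 ^ N)%N -> depth_cdf N.+1 m = near_map (depth_cdf N m).
Proof. by move=> /= ->. Qed.

Hypothesis a_gt0 : 0 < a.
Hypothesis a_lt : a < 1 / 2.

(** The two branches agree at the boundary point 2^N, so it does not matter
    on which side of the case distinction it falls. *)
Lemma far_map0 : far_map 0 = near_map 1.
Proof. by rewrite /far_map /near_map !mulr1 mulr0 subr0. Qed.

Lemma far_map1 : far_map 1 = 1.
Proof.
have [a0 a2] := (a_gt0, a_lt).
have -> : 1 = (1 - 2 * a) / (1 - 2 * a) by rewrite divff // lt0r_neq0 //; lra.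
by rewrite /far_map; congr (_ / _); field; rewrite lt0r_neq0 //; lra.
Qed.

Lemma depth_cdf_max N m : (2 ^ N <= m)%N -> depth_cdf N m = 1.
Proof.
have [a0 a2] := (a_gt0, a_lt).
elim: N m => [|N IH] m; first by rewrite expn0 /= => ->.
rewrite /= expnS mul2n -addnn => mN; rewrite leqNgt ifF; last first.
  by have : (0 < 2 ^ N)%N by [rewrite expn_gt0]; lia.
by rewrite IH ?far_map1 //; lia.
Qed.

Lemma depth_cdf_far N m : depth_cdf N.+1 (2 ^ N + m) = far_map (depth_cdf N m).
Proof.
have [a0 a2] := (a_gt0, a_lt).
rewrite /=; case: m => [|m].
  by rewrite addn0 leqnn depth_cdf0 far_map0 depth_cdf_max.
by rewrite addnS ltnNge leq_addr /= -addnS addKn.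
Qed.

Lemma near_map_gap p r (p01 : 0 <= p <= 1) (r01 : 0 <= r <= 1) :
  near_map r - near_map p = (1 - 2 * a) * (r - p) / ((1 - a * p) * (1 - a * r)).
Proof.
have [a0 a2] := (a_gt0, a_lt).
have ? : 1 - a * p != 0 by apply: lt0r_neq0; nra.
have ? : 1 - a * r != 0 by apply: lt0r_neq0; nra.
by rewrite /near_map; field; apply/andP.
Qed.

Lemma far_map_gap p r (p01 : 0 <= p <= 1) (r01 : 0 <= r <= 1) :
  far_map r - far_map p =
    (1 - 2 * a) * a * (r - p) / ((1 - a - a * p) * (1 - a - a * r)).
Proof.
have [a0 a2] := (a_gt0, a_lt).
have ? : 1 - a - a * p != 0 by apply: lt0r_neq0; nra.
have ? : 1 - a - a * r != 0 by apply: lt0r_neq0; nra.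
by rewrite /far_map; field; apply/andP.
Qed.

Lemma depth_cdf01 N m : 0 <= depth_cdf N m <= 1.
Proof.
have [a0 a2] := (a_gt0, a_lt).
elim: N m => [|N IH] m /=; first by case: (0 < m)%N; rewrite /=; lra.
case: ifP => _; move: (depth_cdf N _) (IH m) (IH (m - 2 ^ N)%N) => p.
  move=> p01 _; rewrite /near_map; apply/andP; split.
    by apply: divr_ge0; nra.
  by rewrite ler_pdivrMr; nra.
move=> _ p01; rewrite /far_map; apply/andP; split.
  by apply: divr_ge0; nra.
by rewrite ler_pdivrMr; nra.
Qed.

(** The value at a dyadic point only depends on the point, since the branch
    taken at each stage is a binary digit of it. *)
Lemma depth_cdf_scale l k m : depth_cdf (l + k) (m * 2 ^ k) = depth_cdf l m.
Proof.
have [a0 a2] := (a_gt0, a_lt).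
elim: l m => [|l IH] m.
  case: m => [|m]; first by rewrite mul0n depth_cdf0.
  by rewrite add0n depth_cdf_max //= mulSn leq_addr.
rewrite addSn /= expnD leq_pmul2r ?expn_gt0 // IH -mulnBl.
by case: ifP => // _; rewrite IH.
Qed.

Lemma depth_cdf_refine l N m :
  (l <= N)%N -> depth_cdf N (m * 2 ^ (N - l)) = depth_cdf l m.
Proof. by move=> lN; rewrite -{1}(subnKC lN) depth_cdf_scale. Qed.

(** The bound [D / (1 + a * D)] means that the inverse of the length of the
    interval grows by at least [a].  The derivative of [near_map] is at most
    (1 - 2a) / (1 - a)^2 < 1. *)
Lemma near_map_gap_le D p r : 0 <= p -> p <= r -> r <= 1 -> r - p <= D -> 0 < D ->
  0 <= near_map r - near_map p <= D / (1 + a * D).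
Proof.
have [a0 a2] := (a_gt0, a_lt).
move=> p0 pr r1 rpD D0; rewrite near_map_gap; [|lra..].
have dp : 1 - a + a * (r - p) <= 1 - a * p by nra.
have dr : 1 - a <= 1 - a * r by nra.
have den : 0 < (1 - a * p) * (1 - a * r) by apply: mulr_gt0; nra.
apply/andP; split; first by apply: divr_ge0; nra.
have le_den : (1 - a) * (1 - a + a * (r - p)) <= (1 - a * p) * (1 - a * r).
  by rewrite mulrC; apply: ler_pM; nra.
rewrite ler_pdivrMr // [leRHS]mulrAC ler_pdivlMr; last by nra.
apply: le_trans (ler_wpM2l (ltW D0) le_den).
have d0 : 0 <= r - p by rewrite subr_ge0.
move: (r - p) rpD d0 => d dD d0.
have h1 : (1 - 2 * a) * d <= D * (1 - a) * (1 - a).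
  have : (1 - 2 * a) * d <= (1 - 2 * a) * D by nra.
  by nra.
(* Of the two factors of the denominator, the lower bound 1 - a of one
   absorbs the slope and the term a * (r - p) of the other the factor
   1 + a * D. *)
have h2 : a * d * D * (1 - 2 * a) <= a * d * D * (1 - a).
  by apply: ler_wpM2l; [rewrite !mulr_ge0 // ltW|lra].
lra.
Qed.

(** In the critical case [a = 1 - 2 * a] the slope at 1 is 1 and no uniform
    contraction is available; the gain [1 + a * D] comes from the left end
    point of the interval, which is at distance at least its length from 1. *)
Lemma far_map_gap_le D p r : a <= 1 - 2 * a ->
  0 <= p -> p <= r -> r <= 1 -> r - p <= D -> 0 < D ->
  0 <= far_map r - far_map p <= D / (1 + a * D).
Proof.
have [a0 a2] := (a_gt0, a_lt).
move=> ax p0 pr r1 rpD D0; rewrite far_map_gap; [|lra..].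
have dp : 1 - 2 * a + a * (r - p) <= 1 - a - a * p by nra.
have dr : 1 - 2 * a <= 1 - a - a * r by nra.
have den : 0 < (1 - a - a * p) * (1 - a - a * r) by apply: mulr_gt0; nra.
apply/andP; split.
  by apply: divr_ge0; rewrite ?(ltW den) // !mulr_ge0 //; lra.
have le_den : (1 - 2 * a) * (1 - 2 * a + a * (r - p)) <=
    (1 - a - a * p) * (1 - a - a * r).
  by rewrite mulrC; apply: ler_pM; nra.
rewrite ler_pdivrMr // [leRHS]mulrAC ler_pdivlMr; last by nra.
apply: le_trans (ler_wpM2l (ltW D0) le_den).
have d0 : 0 <= r - p by rewrite subr_ge0.
move: (r - p) rpD d0 => d dD d0.
have h1 : a * d <= (1 - 2 * a) * D by nra.
have h2 : a * d * D * a <= a * d * D * 1.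
  by apply: ler_wpM2l; [rewrite !mulr_ge0 // ltW|lra].
have -> : (1 - 2 * a) * a * d * (1 + a * D) =
  (1 - 2 * a) * (a * d + a * d * D * a) by ring.
have -> : D * ((1 - 2 * a) * (1 - 2 * a + a * d)) =
  (1 - 2 * a) * ((1 - 2 * a) * D + a * d * D * 1) by ring.
by apply: ler_wpM2l; lra.
Qed.

(** The sequence 1 / (1 + a l) is the orbit of 1 under D -> D / (1 + a D). *)
Lemma depth_cdf_gap l j : a <= 1 - 2 * a ->
  0 <= depth_cdf l j.+1 - depth_cdf l j <= (1 + a * l%:R)^-1.
Proof.
have [a0 a2] := (a_gt0, a_lt).
move=> ax; elim: l j => [|l IH] j.
  by rewrite mulr0 addr0 invr1 /=; case: j => [|j] /=; lra.
have al : 0 <= a * l%:R by rewrite mulr_ge0 // ltW.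
set D := (1 + a * l%:R)^-1 in IH.
have D0 : 0 < D by rewrite invr_gt0; lra.
have -> : (1 + a * l.+1%:R)^-1 = D / (1 + a * D).
  rewrite /D -natr1; field; rewrite !lt0r_neq0 //; lra.
have [jl|lj] := ltnP j (2 ^ l)%N.
  rewrite /= jl (ltnW jl); have := depth_cdf01 l j; have := depth_cdf01 l j.+1.
  by have := IH j => /andP[? ?] /andP[? ?] /andP[? ?]; apply: near_map_gap_le; lra.
rewrite -(subnKC lj) -addnS !depth_cdf_far; set i := (j - _)%N.
have := depth_cdf01 l i; have := depth_cdf01 l i.+1.
by have := IH i => /andP[? ?] /andP[? ?] /andP[? ?]; apply: far_map_gap_le; lra.
Qed.

(** [(1 - 2 * a) / a] is the fixed point of [far_map] other than 1, and the
    value at the last point before 1 is the orbit of 0 under the increasing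
    map [far_map]. *)
Lemma depth_cdf_below_max l : 1 - 2 * a < a ->
  depth_cdf l (2 ^ l - 1) <= (1 - 2 * a) / a.
Proof.
have [a0 a2] := (a_gt0, a_lt).
move=> xa; have x0 : 0 < 1 - 2 * a by lra.
elim: l => [|l IH]; first by rewrite /= divr_ge0 ?ltW.
have -> : (2 ^ l.+1 - 1 = 2 ^ l + (2 ^ l - 1))%N.
  by have : (0 < 2 ^ l)%N by [rewrite expn_gt0]; rewrite expnS; lia.
rewrite depth_cdf_far /far_map ler_pM2l // lef_pV2 ?posrE //.
  by move: IH; rewrite ler_pdivlMr //; lra.
by have := depth_cdf01 l (2 ^ l - 1); nra.
Qed.

(** The jump at 1 is at least 1 - (1 - 2a) / a.  Each of the m binary digits
    of k / 2^m transports it by one of the two branches, whose difference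
    quotients are at least (1 - 2a) a. *)
Lemma depth_cdf_jump m k l : 1 - 2 * a < a -> (0 < k <= 2 ^ m)%N -> (m <= l)%N ->
  (1 - (1 - 2 * a) / a) * ((1 - 2 * a) * a) ^+ m <=
    depth_cdf l (k * 2 ^ (l - m)) - depth_cdf l (k * 2 ^ (l - m) - 1).
Proof.
have [a0 a2] := (a_gt0, a_lt).
move=> xa; have x0 : 0 < 1 - 2 * a by lra.
elim: m k l => [|m IH] k l.
  case: k => [|[|k]] //= _ _; rewrite mul1n subn0 mulr1 depth_cdf_max //.
  by have := depth_cdf_below_max l xa; lra.
case: l => // l kl ml; rewrite subSS exprSr mulrA.
have c0 : 0 <= (1 - (1 - 2 * a) / a) * ((1 - 2 * a) * a) ^+ m.
  rewrite mulr_ge0 // ?exprn_ge0 // ?mulr_ge0 // ?ltW //.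
  by rewrite subr_gt0 ltr_pdivrMr ?mul1r.
have t0 : (0 < 2 ^ (l - m))%N by rewrite expn_gt0.
have el : (2 ^ l = 2 ^ m * 2 ^ (l - m))%N by rewrite -expnD subnKC.
have [km|mk] := leqP k (2 ^ m).
  have /IH/(_ ml) : (0 < k <= 2 ^ m)%N by lia.
  have le1 : (k * 2 ^ (l - m) <= 2 ^ l)%N by rewrite el leq_pmul2r.
  rewrite /= le1 (leq_trans (leq_subr _ _) le1).
  have := depth_cdf01 l (k * 2 ^ (l - m)).
  have := depth_cdf01 l (k * 2 ^ (l - m) - 1).
  move: (depth_cdf _ _) (depth_cdf _ _) (_ * _ ^+ m) c0 => r p c c0 p01 r01 c_le.
  rewrite near_map_gap // ler_pdivlMr; last by apply: mulr_gt0; nra.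
  have xd : c * (1 - 2 * a) <= (1 - 2 * a) * (r - p) by nra.
  apply: le_trans xd; rewrite [c * _]mulrA -[leLHS]mulrA ler_piMr //.
    by rewrite mulr_ge0 // ltW.
  have q1 : 0 <= 1 - a * p <= 1 by nra.
  have q2 : 0 <= 1 - a * r <= 1 by nra.
  by rewrite mulr_ile1 ?mulr_ge0 ?mulr_ile1 //; lra.
have /IH/(_ ml) : (0 < k - 2 ^ m <= 2 ^ m)%N by rewrite expnS in kl; lia.
have -> : (k * 2 ^ (l - m) = 2 ^ l + (k - 2 ^ m) * 2 ^ (l - m))%N.
  by rewrite el -mulnDl subnKC // ltnW.
have -> : (2 ^ l + (k - 2 ^ m) * 2 ^ (l - m) - 1 =
    2 ^ l + ((k - 2 ^ m) * 2 ^ (l - m) - 1))%N.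
  by rewrite addnBA // muln_gt0 t0 subn_gt0 mk.
rewrite !depth_cdf_far; set i := (_ * _)%N.
have := depth_cdf01 l i; have := depth_cdf01 l (i - 1).
move: (depth_cdf _ _) (depth_cdf _ _) (_ * _ ^+ m) c0 => r p c c0 p01 r01 c_le.
rewrite far_map_gap // ler_pdivlMr; last by apply: mulr_gt0; nra.
have xd : c * ((1 - 2 * a) * a) <= (1 - 2 * a) * a * (r - p).
  by rewrite mulrC ler_wpM2l // mulr_ge0; lra.
apply: le_trans xd; rewrite ler_piMr //; first by rewrite !mulr_ge0 //; lra.
have q1 : 0 <= 1 - a - a * p <= 1 by nra.
have q2 : 0 <= 1 - a - a * r <= 1 by nra.
by rewrite mulr_ile1 //; lra.
Qed.

End DepthLaw.

(** * Summation over itineraries *)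

Section Sums.
Variable R : realType.

Lemma esumZl (T : choiceType) (A : set T) (c : R) (a : T -> \bar R) :
  0 <= c -> (forall x, 0 <= a x)%E ->
  (\esum_(x in A) (c%:E * a x) = c%:E * \esum_(x in A) a x)%E.
Proof.
move=> c0 a0.
have le (d : R) (b : T -> \bar R) : 0 <= d -> (forall x, 0 <= b x)%E ->
    (\esum_(x in A) (d%:E * b x) <= d%:E * \esum_(x in A) b x)%E.
  move=> d0 b0; apply: ge_ereal_sup => _ [X [finX XA] <-].
  rewrite -ge0_mule_fsumr // lee_wpmul2l ?lee_fin //.
  by apply: esum_ge; exists X.
apply/eqP; rewrite eq_le le //=.
have [->|cn0] := eqVneq c 0; first by rewrite mul0e esum_ge0 // => x _; rewrite mul0e.
have cp : 0 < c by rewrite lt_neqAle eq_sym cn0.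
have := le c^-1 (fun x => c%:E * a x)%E.
rewrite invr_ge0 => /(_ c0 (fun x => mule_ge0 _ (a0 x))); rewrite lee_fin => /(_ c0).
under eq_esum do rewrite muleA -EFinM mulVf // mul1e.
by rewrite muleC lee_pdivlMr // muleC.
Qed.

Lemma esum_prod (T T' : choiceType) (A : set T) (B : set T') (f : T -> R)
    (g : T' -> R) (p q : R) :
  (forall x, 0 <= f x) -> (forall x, 0 <= g x) ->
  \esum_(x in A) (f x)%:E = p%:E -> \esum_(x in B) (g x)%:E = q%:E ->
  \esum_(z in A `*` B) (f z.1 * g z.2)%:E = (p * q)%:E.
Proof.
move=> f0 g0 fp gq.
have q0 : 0 <= q by rewrite -lee_fin -gq; apply: esum_ge0 => x _; rewrite lee_fin.
rewrite -(esum_esum (J := fun=> B) (a := fun i j => (f i * g j)%:E)); last first.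
  by move=> i j _ _; rewrite lee_fin mulr_ge0.
rewrite (eq_esum (b := fun i => (q%:E * (f i)%:E)%E)); last first.
  move=> i _; under eq_esum do rewrite EFinM.
  by rewrite esumZl // ?gq 1?muleC // => x; rewrite lee_fin.
by rewrite esumZl // ?fp -?EFinM 1?mulrC // => x; rewrite lee_fin.
Qed.

Lemma esum_geometric (q : R) : 0 <= q < 1 ->
  \esum_(k in [set: nat]) (q ^+ k)%:E = ((1 - q)^-1)%:E.
Proof.
move=> /andP[q0 q1]; rewrite -nneseries_esumT; last first.
  by move=> n; rewrite lee_fin exprn_ge0.
apply/cvg_lim => //; apply: cvg_EFin.
  by apply: nearW => n; rewrite sumEFin.
have := @cvg_geometric_series _ 1 q; rewrite ger0_norm // mul1r => /(_ q1).
rewrite [X in _ -> X @ _ --> _](_ : _ = series (geometric 1 q)) //.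
apply/funext => n /=; rewrite sumEFin /series /=.
by apply: eq_bigr => i _; rewrite mul1r.
Qed.

(** Words of length k contribute [q ^+ k]. *)
Lemma esum_words (T : choiceType) (C : pred T) (g : T -> R) (q : R) :
  (forall x, 0 <= g x) -> 0 <= q < 1 ->
  \esum_(x in [set x | C x]) (g x)%:E = q%:E ->
  \esum_(l in [set l | all C l]) (\prod_(x <- l) g x)%:E = ((1 - q)^-1)%:E.
Proof.
move=> g0 q01 gq.
have p0 (l : seq T) : 0 <= \prod_(x <- l) g x by apply: prodr_ge0.
pose J k := [set l | size l = k /\ all C l].
have -> : [set l | all C l] = \bigcup_(k in setT) J k.
  by apply/seteqP; split=> [l Cl|l [k _ []//]]; exists (size l).
rewrite esum_bigcupT; last 2 first.
- by apply/trivIsetP => i j _ _ /eqP ij; apply/seteqP; split=> // l [[li _] [lj _]];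
    apply: ij; rewrite -li -lj.
- by move=> l; rewrite lee_fin.
rewrite -esum_geometric //; apply: eq_esum => k _.
elim: k => [|k IH].
  rewrite (_ : J 0%N = [set [::]]).
    by rewrite esum_set1 ?big_nil.
  by apply/seteqP; split=> [l [/size0nil]//|l ->].
rewrite (reindex_esum ([set x | C x] `*` J k) _ (fun z => z.1 :: z.2)); last first.
  split=> [[x l] /= [Cx [lk Cl]]|[x l] [y m] _ _ [-> ->]//|].
    by split; rewrite /= ?lk ?Cx.
  by move=> [|x l] [] //= [lk] /andP[Cx Cl]; exists (x, l).
under eq_esum do rewrite big_cons.
rewrite exprS; exact: (esum_prod g0 p0 gq IH).
Qed.

End Sums.

Section DepthDistribution.
Variables (R : realType) (u : R).
Hypothesis u_gt0 : 0 < u.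
Let a : R := excursion_mass u.

Lemma x_of_gt0 : 0 < x_of u.
Proof. by rewrite /x_of divr_gt0 // ltr_wpDr ?sqrtr_ge0. Qed.

(** The normalization: summing over k excursions, on either side each, gives
    x / (1 - 2a) = 1. *)
Lemma x_ofE : x_of u = 1 - 2 * excursion_mass u.
Proof.
rewrite /excursion_mass /x_of.
have h : Num.sqrt (1 + 8 * u ^+ 2) ^+ 2 = 1 + 8 * u ^+ 2.
  by rewrite sqr_sqrtr // addr_ge0 // mulr_ge0 // exprn_ge0 // ltW.
have t0 := sqrtr_ge0 (1 + 8 * u ^+ 2).
move: (Num.sqrt _) h t0 => t h t0.
have -> : u ^+ 2 = (t ^+ 2 - 1) / 8 by rewrite h; field.
by field; rewrite lt0r_neq0 //; lra.
Qed.

Lemma excursion_mass_gt0 : 0 < a.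
Proof. by rewrite /a /excursion_mass mulr_gt0 // exprn_gt0 // x_of_gt0. Qed.

Lemma excursion_mass_lt : a < 1 / 2.
Proof. by have := x_of_gt0; rewrite x_ofE -/a; lra. Qed.

Lemma weight_ge0 N (c : itinerary N) : 0 <= weight u c.
Proof.
elim: N c => [|N IH] c; first exact: ler01.
rewrite (weightS u c) !mulr_ge0 ?(ltW x_of_gt0) //.
by apply: prodr_ge0 => x _; rewrite !mulr_ge0 // ltW // excursion_mass_gt0.
Qed.

Lemma esum_excursion (T : choiceType) (w : T -> R) (b : bool) (A B : set T)
    (p q : R) : (forall c, 0 <= w c) ->
  \esum_(c in A) (w c)%:E = p%:E -> \esum_(c in B) (w c)%:E = q%:E ->
  \esum_(x in [set x : bool * (T * T) | x.1 = b /\ A x.2.1 /\ B x.2.2])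
    (a * (w x.2.1 * w x.2.2))%:E = (a * (p * q))%:E.
Proof.
move=> w0 wA wB.
have b1 : \esum_(b in [set b]) a%:E = a%:E.
  by rewrite esum_set1 // lee_fin ltW // excursion_mass_gt0.
have ww0 (z : T * T) : 0 <= w z.1 * w z.2 by rewrite mulr_ge0.
rewrite -(esum_prod (fun=> ltW excursion_mass_gt0) ww0 b1 (esum_prod w0 w0 wA wB)).
by [].
Qed.

(** A condition that bears separately on each excursion and on the last
    passage from 0 gives a geometric series. *)
Lemma esum_weight_cond N (C : pred (bool * (itinerary N * itinerary N)))
    (D : set (itinerary N)) (p q : R) : 0 <= q < 1 ->
  \esum_(c in setT) (weight u (c : itinerary N))%:E = 1%:E ->
  \esum_(x in [set x | C x]) (a * (weight u x.2.1 * weight u x.2.2))%:E = q%:E ->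
  \esum_(c in D) (weight u c)%:E = p%:E ->
  \esum_(c in [set c : itinerary N.+1 | all C c.1 /\ D c.2.1]) (weight u c)%:E =
    (x_of u * p / (1 - q))%:E.
Proof.
move=> q01 w1 Cq Dp.
have w0 := @weight_ge0 N.
have e0 (x : bool * (itinerary N * itinerary N)) :
  0 <= a * (weight u x.2.1 * weight u x.2.2).
  by rewrite !mulr_ge0 // ltW // excursion_mass_gt0.
have ww0 (z : itinerary N * itinerary N) : 0 <= weight u z.1 * weight u z.2.
  by rewrite mulr_ge0.
have last_pair : \esum_(z in D `*` [set: itinerary N])
    (x_of u * (weight u z.1 * weight u z.2))%:E = (x_of u * p)%:E.
  under eq_esum do rewrite EFinM.
  rewrite esumZl ?(ltW x_of_gt0) //.
  by rewrite (esum_prod w0 w0 Dp w1) mulr1.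
have x0 (z : itinerary N * itinerary N) :
    0 <= x_of u * (weight u z.1 * weight u z.2).
  by rewrite mulr_ge0 // ltW // x_of_gt0.
have p0 (l : seq (bool * (itinerary N * itinerary N))) :
  0 <= \prod_(x <- l) (a * (weight u x.2.1 * weight u x.2.2)) by apply: prodr_ge0.
rewrite mulrC -(esum_prod p0 x0 (esum_words e0 q01 Cq) last_pair).
congr esum; apply/seteqP; split=> [[l [c d]] /= []|[l [c d]] /= [Cl []]] //.
Qed.

(** In the recursion, a right excursion has mass [a * F] or [a] and a left one
    0 or [a * F], according to whether the bound is below or above 2^N. *)
Lemma esum_shallow N m :
  \esum_(c in [set c : itinerary N | shallow m c]) (weight u c)%:E =
    (depth_cdf a N m)%:E.
Proof.
have [a0 a2] := (excursion_mass_gt0, excursion_mass_lt).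
elim: N m => [|N IH] m.
  case: m => [|m]; last first.
    rewrite (_ : [set c | _] = [set tt]) ?esum_set1 //.
    by apply/seteqP; split=> -[].
  by rewrite (_ : [set c | _] = set0) ?esum_set0 //; apply/seteqP; split.
have w0 := @weight_ge0 N.
have total : \esum_(c in [set: itinerary N]) (weight u c)%:E = 1%:E.
  rewrite -(depth_cdf_max a0 a2 (leqnn (2 ^ N))) -IH; congr esum.
  by apply/seteqP; split=> c //= _; exact: shallow_max.
have := depth_cdf01 a0 a2 N.
have [mN|/ltnW Nm] := leqP m (2 ^ N)%N => F01.
  have Fm := F01 m; rewrite depth_cdf_near // /near_map.
  have q01 : 0 <= a * (depth_cdf a N m * 1) < 1 by nra.
  have := esum_excursion true w0 (IH m) total.
  rewrite (_ : [set x | _] = [set x : bool * (itinerary N * itinerary N) |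
      x.1 && shallow m x.2.1]); last first.
    by apply/seteqP; split=> -[b [c d]] /= => [[-> [-> _]]|/andP[-> ->]].
  move=> /(esum_weight_cond q01 total)/(_ (IH m)).
  rewrite mulr1 x_ofE => <-; congr esum; apply/seteqP; split=> c /=.
    by rewrite shallow_near // => /andP[].
  by rewrite shallow_near // => -[-> ->].
rewrite -(subnKC Nm) depth_cdf_far //; set n := (m - _)%N.
have Fn := F01 n; rewrite /far_map.
have q01 : 0 <= a * (1 * 1) + a * (1 * depth_cdf a N n) < 1 by nra.
have := esum_excursion true w0 total total.
have := esum_excursion false w0 total (IH n).
move=> ef et.
have eC : \esum_(x in [set x : bool * (itinerary N * itinerary N) |
      x.1 || shallow n x.2.2]) (a * (weight u x.2.1 * weight u x.2.2))%:E =
    (a * (1 * 1) + a * (1 * depth_cdf a N n))%:E.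
  rewrite (esumID [set x : bool * (itinerary N * itinerary N) | x.1]); last first.
    by move=> x _; rewrite lee_fin !mulr_ge0 // ltW.
  rewrite EFinD -ef -et; congr (_ + _)%E; congr esum; apply/seteqP.
    by split=> -[[] [c d]] //= [].
  by split=> -[[] [c d]] //= [] // ? [] //.
have := esum_weight_cond q01 total eC total.
rewrite !mulr1 mul1r x_ofE opprD addrA => <-; congr esum.
apply/seteqP; split=> c /=; first by rewrite shallow_far.
by rewrite shallow_far => -[].
Qed.

Lemma esum_weight N : \esum_(c in [set: itinerary N]) (weight u c)%:E = 1%:E.
Proof.
rewrite -(depth_cdf_max excursion_mass_gt0 excursion_mass_lt (leqnn (2 ^ N))).
rewrite -esum_shallow; congr esum.
by apply/seteqP; split=> c //= _; exact: shallow_max.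
Qed.

End DepthDistribution.

(** * Cylinders of itineraries and the limit law *)

(** The indicator of [A] is one of the simple functions below [g] in the
    supremum that defines the integral of a nonnegative function. *)
Lemma integral_ge_measure d (T : measurableType d) (R : realType)
    (mu : {measure set T -> \bar R}) (A : set T) (g : T -> R) :
  measurable A -> (forall x, 0 <= g x) -> (forall x, A x -> 1 <= g x) ->
  (mu A <= \int[mu]_x (g x)%:E)%E.
Proof.
move=> mA g0 g1; rewrite ge0_integralTE; last by move=> x; rewrite lee_fin.
rewrite -sintegral_indic; apply: ereal_sup_ubound.
exists (indic_nnsfun R mA) => // x; rewrite lee_fin.
rewrite (_ : HBNNSimple.NonNegSimpleFun.sort _ x = \1_A x) // indicE.
by case: (boolP (x \in A)) => [/set_mem/g1|_].
Qed.

(** The discrete intermediate value theorem. *)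
Lemma unit_path_between (s : seq int) (n : nat) (z : int) :
  sorted unit_step s -> s`_0 = 0 -> (n < size s)%N ->
  (0 <= z <= s`_n) || (s`_n <= z <= 0) -> exists2 j, (j <= n)%N & s`_j = z.
Proof.
move=> step s0; elim: n z => [|n IH] z ns.
  by rewrite s0 => zb; exists 0%N => //; rewrite s0; lia.
have := (sortedP 0 step) n ns; rewrite /unit_step => /eqP dn zb.
(* The only new value that the last step can bring between 0 and the end
   is the end itself. *)
have [zn|zn] := boolP ((0 <= z <= s`_n) || (s`_n <= z <= 0)).
  by have [j jn <-] := IH z (ltnW ns) zn; exists j => //; exact: leqW.
by exists n.+1 => //; lia.
Qed.

(** Reflection gives the paths of both [W_plus] and [W_minus]. *)
Definition oriented_path N (b : bool) (c : itinerary N) : seq int :=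
  [seq orient b * v | v <- path_of c].

Lemma oriented_path_minus N (c : itinerary N) :
  oriented_path false c = path_opp (path_of c).
Proof. by apply: eq_map => v; rewrite mulN1r. Qed.

Lemma oriented_path_plus N (c : itinerary N) : oriented_path true c = path_of c.
Proof. by rewrite -[RHS]map_id; apply: eq_map => v; rewrite mul1r. Qed.

Lemma oriented_path_woven N b (c : itinerary N) :
  oriented_path b c = woven (2 ^+ N) 0 [:: (b, body c)].
Proof.
rewrite /oriented_path /path_of map_rcons /woven /corner /= cats0 big_seq1 add0r.
by congr rcons; [apply: eq_map => v; rewrite add0r|rewrite mulrC].
Qed.

Lemma oriented_path_finite N b (c : itinerary N) : finite_path (oriented_path b c).
Proof.
have hc : all (fun p => crossing (2 ^+ N) p.2) [:: (b, body c)].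
  by rewrite /= body_crossing.
by rewrite /finite_path oriented_path_woven (woven_head 0 hc) woven_sorted.
Qed.

Lemma size_oriented_path N b (c : itinerary N) :
  size (oriented_path b c) = (size (body c)).+1.
Proof. by rewrite size_map size_rcons. Qed.

Lemma path_opp_W_minus N (c : itinerary N) :
  W_minus N (path_opp (path_of c)).
Proof.
have hc : all (fun p => crossing (2 ^+ N) p.2) [:: (false, body c)].
  by rewrite /= body_crossing.
have hit1 : hit N (oriented_path false c) 1 = Some (size (body c)).
  by rewrite oriented_path_woven hit_woven // /duration big_seq1.
rewrite /W_minus -oriented_path_minus oriented_path_finite hit1.
rewrite /path_length size_oriented_path succnK eqxx /=.
rewrite oriented_path_woven /woven nth_rcons size_weave /duration big_seq1.
by rewrite ltnn eqxx /corner big_seq1 add0r mulrN1.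
Qed.

(** The two reflected copies have probability half the weight each and the
    same range, so they are kept together. *)
Definition track N (c : itinerary N) : set W_infty :=
  cylinder (oriented_path true c) `|` cylinder (oriented_path false c).

Lemma measurable_cylinder s : finite_path s -> measurable (cylinder s : set W_infty).
Proof. by move=> fs; apply: sub_sigma_algebra; exists s. Qed.

Lemma measurable_track N (c : itinerary N) : measurable (track c).
Proof. by apply: measurableU; apply: measurable_cylinder; exact: oriented_path_finite. Qed.

Lemma at_time_cylinder N b (c : itinerary N) (w : W_infty) j :
  cylinder (oriented_path b c) w -> (j <= size (body c))%N ->
  at_time w j = orient b * (path_of c)`_j.
Proof.
by move=> cw jc; rewrite cw ?size_oriented_path // (nth_map 0) // size_rcons.
Qed.

Lemma path_of_nth N (c : itinerary N) j : (j < size (body c))%N ->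
  `|(path_of c)`_j| < 2 ^+ N.
Proof. by move=> jc; rewrite nth_rcons jc; apply: body_lt; exact: mem_nth. Qed.

Lemma path_of_last N (c : itinerary N) : (path_of c)`_(size (body c)) = 2 ^+ N.
Proof. by rewrite nth_rcons ltnn eqxx. Qed.

Lemma normr_orient b (v : int) : `|orient b * v| = `|v|.
Proof. by case: b; rewrite /= ?mul1r // mulN1r normrN. Qed.

(** The first time at which the infinite path is at distance 2^N from 0 gives
    the length of the crossing, and its position then the side. *)
Lemma cylinder_inj N b c b' c' (w : W_infty) :
  cylinder (@oriented_path N b c) w -> cylinder (@oriented_path N b' c') w ->
  (b, c) = (b', c').
Proof.
move=> cw cw'.
have lt b1 c1 b2 c2 : cylinder (@oriented_path N b1 c1) w ->
    cylinder (@oriented_path N b2 c2) w -> (size (body c1) <= size (body c2))%N.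
  move=> h1 h2; rewrite leqNgt; apply/negP => lt12.
  have := path_of_nth lt12; rewrite -(normr_orient b1) -(at_time_cylinder h1) ?(ltnW lt12) //.
  by rewrite (at_time_cylinder h2) // path_of_last normr_orient ger0_norm ?exprn_ge0 ?ltxx.
have sz : size (body c) = size (body c').
  by apply/eqP; rewrite eqn_leq (lt _ _ _ _ cw cw') (lt _ _ _ _ cw' cw).
have eb : b = b'.
  have := at_time_cylinder cw (leqnn _).
  rewrite {1}sz (at_time_cylinder cw' (leqnn _)) !path_of_last => /esym.
  have : (0 : int) < 2 ^+ N by rewrite exprn_gt0.
  by case: b b' {cw cw'} => [] [] //=; lia.
congr pair => //; apply: path_of_inj; apply: (@eq_from_nth _ 0).
  by rewrite !size_rcons sz.
move=> j; rewrite size_rcons ltnS => jc.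
rewrite -[LHS](orientK b) -(at_time_cylinder cw) // [in LHS]eb.
by rewrite (at_time_cylinder cw') -?sz // orientK.
Qed.

Lemma trivIset_track N (D : set (itinerary N)) : trivIset D (@track N).
Proof.
apply/trivIsetP => c c' _ _ /eqP cc'; apply/seteqP; split=> // w [].
by move=> [cw|cw] [cw'|cw']; apply: cc'; have [] := cylinder_inj cw cw'.
Qed.

Lemma track_measure (R : realType) (u : R) (P : probability W_infty R) N
    (c : itinerary N) : is_path_measure u P -> (1 <= N)%N ->
  P (track c) = (weight u c)%:E.
Proof.
move=> hP; case: N c => // N c _.
have Wp : W_plus N.+1 (path_of c) by apply: crossing_W_plus; exact: body_crossing.
have ePp := (hP N.+1 (path_of c) isT).1 Wp.
have ePm := (hP N.+1 _ isT).2 (path_opp_W_minus c).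
rewrite /track measureU; last 3 first.
- by apply: measurable_cylinder; exact: oriented_path_finite.
- by apply: measurable_cylinder; exact: oriented_path_finite.
- by apply/seteqP; split=> // w [cw cw']; have [] := cylinder_inj cw cw'.
rewrite oriented_path_plus oriented_path_minus.
move: ePp ePm; rewrite /mass_minus.
have -> : path_opp (path_opp (path_of c)) = path_of c.
  by rewrite /path_opp -map_comp -[RHS]map_id; apply: eq_map => v /=; rewrite opprK.
rewrite mass_plus_path_of => ePp ePm.
apply: (etrans (f_equal2 (fun x y => (x + y)%E) ePp ePm)).
rewrite -EFinD; congr EFin.
by rewrite -mulrDl -[2^-1]mul1r -splitr mul1r.
Qed.

(** A sum of nonnegative terms is the supremum of its finite partial sums, and
    finitely many tracks are disjoint measurable sets. *)
Lemma integral_ge_esum (R : realType) (u : R) (P : probability W_infty R) N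
    (A : set (itinerary N)) (g : W_infty -> R) :
  is_path_measure u P -> (1 <= N)%N ->
  (forall w, 0 <= g w) -> (forall c w, A c -> track c w -> 1 <= g w) ->
  (\esum_(c in A) (weight u c)%:E <= \int[P]_w (g w)%:E)%E.
Proof.
move=> hP N1 g0 g1; apply: ge_ereal_sup => _ [X [finX XA] <-].
under eq_fsbigr do rewrite -(track_measure _ hP N1).
rewrite -measure_fin_bigcup //; last 2 first.
- exact: trivIset_track.
- by move=> c _; exact: measurable_track.
apply: integral_ge_measure => //.
  by apply: fin_bigcup_measurable => // c _; exact: measurable_track.
by move=> w [c /XA Ac cw]; exact: g1 cw.
Qed.

Lemma visited_before_cylinder N b (c : itinerary N) (w : W_infty) :
  cylinder (oriented_path b c) w ->
  visited_before N w = [set` [fset v | v in [seq orient b * v | v <- body c]]%fset].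
Proof.
move=> cw; apply/seteqP; split=> v /=.
  move=> [j <- nj].
  have jc : (j < size (body c))%N.
    rewrite ltnNge; apply/negP => /nj.
    rewrite (at_time_cylinder cw) // path_of_last.
    by case: b {cw} => /=; rewrite ?mul1r ?mulN1r => -[].
  rewrite !inE /= (at_time_cylinder cw (ltnW jc)) nth_rcons jc.
  by apply: map_f; exact: mem_nth.
rewrite !inE => /mapP[x /(nthP 0)[j jc <-] ->]; exists j.
  by rewrite (at_time_cylinder cw (ltnW jc)) nth_rcons jc.
move=> i ij; have ic := leq_ltn_trans ij jc.
have := path_of_nth ic; rewrite -(normr_orient b) -(at_time_cylinder cw (ltnW ic)).
have : (0 : int) < 2 ^+ N by rewrite exprn_gt0.
by move=> h0 hlt; split=> e; move: hlt; rewrite e ?normrN gtr0_norm // ltxx.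
Qed.

Lemma orient_inj b : injective ( *%R (orient b)).
Proof. exact: can_inj (orientK b). Qed.

Lemma range_size_track N (c : itinerary N) (w : W_infty) :
  track c w -> range_size N w = size (undup (body c)).
Proof.
rewrite /range_size; case=> /visited_before_cylinder ->;
  by rewrite set_fsetK card_fseq (undup_map_inj (@orient_inj _)) size_map.
Qed.

(** The visited points form an interval with upper end 2^N - 1, so that their
    number tells the lower end. *)
Lemma shallowE N m (c : itinerary N) :
  shallow m c = (size (undup (body c)) < 2 ^ N + m)%N.
Proof.
have N0 : (0 < 2 ^ N)%N by rewrite expn_gt0.
apply/idP/idP => [mc|].
  suff : (size (undup (body c)) <= 2 ^ N + m - 1)%N by lia.
  rewrite -[leqRHS](size_iota 0) -(size_map (fun i : nat => (2 ^ N)%:Z - i.+1%:Z)).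
  apply: uniq_leq_size (undup_uniq _) _ => v; rewrite mem_undup => vc.
  have := body_lt vc; have /allP/(_ _ vc) := mc; rewrite pow2Z => mv vN.
  apply/mapP; exists (absz ((2 ^ N)%:Z - 1 - v)%R); last by lia.
  by rewrite mem_iota; lia.
apply: contraTT => /allPn[v vc]; rewrite -leNgt -leqNgt => vm.
rewrite -[leqLHS](size_iota 0) -(size_map (fun i : nat => (2 ^ N)%:Z - i.+1%:Z)).
apply: uniq_leq_size => [|z].
  by rewrite map_inj_uniq ?iota_uniq // => i j; lia.
move=> /mapP[i]; rewrite mem_iota add0n => /andP[_ iN] ez; rewrite mem_undup.
have /and3P[_ _ step] := body_crossing c; rewrite -/(path_of c) in step.
have p0 : (path_of c)`_0 = 0.
  by rewrite nth_rcons (crossing_size (body_crossing c)) (crossing0 (body_crossing c)).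
(* Points above 0 are passed on the way to 2^N, the others on the way to the
   value v <= -m. *)
have [n nc en] : exists2 n, (n <= size (body c))%N &
    (0 <= z <= (path_of c)`_n) || ((path_of c)`_n <= z <= 0).
  case: (leP 0 z) => z0.
    by exists (size (body c)) => //; rewrite path_of_last pow2Z; lia.
  move/(nthP 0): vc => [n nc en]; exists n; first exact: ltnW.
  by rewrite nth_rcons nc en; lia.
have nc' : (n < size (path_of c))%N by rewrite size_rcons.
have [j jn ej] := unit_path_between step p0 nc' en.
have jc : (j < size (body c))%N.
  rewrite ltn_neqAle (leq_trans jn nc) andbT; apply/negP => /eqP jE.
  by move: ej; rewrite jE path_of_last pow2Z; lia.
by rewrite -ej nth_rcons jc; exact: mem_nth.
Qed.

Lemma shallow_scaled_range (R : realType) N m (c : itinerary N) (w : W_infty) :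
  track c w -> shallow m c = (scaled_range R N w < m%:R / 2 ^+ N).
Proof.
move=> cw; rewrite shallowE /scaled_range (range_size_track cw).
have N0 : 0 < 2 ^+ N :> R by rewrite exprn_gt0.
rewrite ltr_pdivlMr // mulrBl mul1r divfK ?lt0r_neq0 // ltrBlDr addrC.
by rewrite -natrX -natrD ltr_nat.
Qed.

(** One half of the portmanteau theorem, with a test function [f] below the
    indicator of [K]. *)
Lemma limit_law_ge (R : realType) (u : R) (P : probability W_infty R)
    (Q : probability (measurableTypeR R) R) (f : R -> R) (K : set R) (q : R)
    (n0 : nat) :
  is_path_measure u P -> is_limit_law P Q -> continuous f ->
  (forall x, 0 <= f x <= 1) -> measurable K -> (forall x, ~ K x -> f x = 0) ->
  (forall N, (n0 <= N)%N -> exists A : set (itinerary N),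
    (q%:E <= \esum_(c in A) (weight u c)%:E)%E /\
    (forall c w, A c -> track c w -> f (scaled_range R N w) = 1)) ->
  (q%:E <= Q K)%E.
Proof.
move=> hP [_ hQ] cf f01 mK fK hA.
have bf : bounded_fun f.
  exists 1; split=> // M M1 x _; rewrite /= ger0_norm; last by have /andP[] := f01 x.
  by apply: le_trans (ltW M1); have /andP[] := f01 x.
apply: (@le_trans _ _ (\int[Q]_x (f x)%:E)%E).
  apply: cvge_ge (hQ f cf bf); near=> N.
  have n0N : (n0 <= N)%N by near: N; exact: nbhs_infty_ge.
  have N1 : (1 <= N)%N by near: N; exact: nbhs_infty_ge.
  have [A [qA fA]] := hA N n0N; apply: le_trans qA _.
  apply: (integral_ge_esum hP N1) => [w|c w Ac cw].
    by have /andP[] := f01 (scaled_range R N w).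
  by rewrite (fA c w Ac cw).
rewrite -[K]setIT -integral_indic //; apply: ge0_le_integral => //.
- by move=> x _; rewrite lee_fin; have /andP[] := f01 x.
- apply/measurable_EFinP; exact: continuous_measurable_fun.
- by apply/measurable_EFinP; exact: measurable_indic.
- move=> x _; rewrite lee_fin indicE; case: (boolP (x \in K)) => [_|].
    by have /andP[] := f01 x.
  by rewrite notin_setE => /fK ->.
Unshelve. all: by end_near. Qed.

(** * Atoms *)

(** The equation forces [s] to be finite. *)
Lemma adde_eq_sub (R : realType) (p q : R) (s : \bar R) :
  (p%:E = q%:E + s -> s = (p - q)%:E)%E.
Proof. by case: s => [s| |] //= [->]; rewrite addrAC subrr add0r. Qed.

Section Bands.
Variables (R : realType) (u : R).
Hypothesis u_gt0 : 0 < u.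
Let a : R := excursion_mass u.

Definition band N (m1 m2 : nat) : set (itinerary N) :=
  [set c | ~~ shallow m1 c && shallow m2 c].

Lemma shallow_le N m1 m2 (c : itinerary N) : (m1 <= m2)%N ->
  shallow m1 c -> shallow m2 c.
Proof. by move=> m12; apply: sub_all => v; lia. Qed.

Lemma esum_band N m1 m2 : (m1 <= m2)%N ->
  \esum_(c in @band N m1 m2) (weight u c)%:E =
    (depth_cdf a N m2 - depth_cdf a N m1)%:E.
Proof.
move=> m12; apply: adde_eq_sub; rewrite -!esum_shallow //.
rewrite (esumID [set c : itinerary N | shallow m1 c]); last first.
  by move=> c _; rewrite lee_fin weight_ge0.
congr (_ + _)%E; congr esum; apply/seteqP; split=> c /=.
- by case.
- by move=> m1c; split=> //; exact: shallow_le m1c.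
- by move=> [m2c /negP m1c]; apply/andP.
- by move=> /andP[/negP].
Qed.

Lemma esum_bandC N m1 m2 : (m1 <= m2)%N ->
  \esum_(c in ~` @band N m1 m2) (weight u c)%:E =
    (1 - (depth_cdf a N m2 - depth_cdf a N m1))%:E.
Proof.
move=> m12; apply: adde_eq_sub; rewrite -esum_band // -(esum_weight u_gt0 N).
rewrite (esumID (@band N m1 m2)) ?setTI // => c _.
by rewrite lee_fin weight_ge0.
Qed.

Lemma band_scaled_range N m1 m2 (c : itinerary N) (w : W_infty) : track c w ->
  (band m1 m2 c) <-> (m1%:R / 2 ^+ N <= scaled_range R N w < m2%:R / 2 ^+ N).
Proof.
move=> cw; rewrite /band /= !(shallow_scaled_range R _ cw) -leNgt.
by split.
Qed.

End Bands.

Lemma scaled_dist_continuous (R : realType) (e x : R) :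
  continuous (fun y : R => e * `|y - x| : R).
Proof.
move=> y; apply: cvgM; first exact: cvg_cst.
by apply: cvg_norm; apply: cvgB; [exact: cvg_id|exact: cvg_cst].
Qed.

Lemma dyadic_refine (R : realType) l N (k : nat) : (l <= N)%N ->
  (k * 2 ^ (N - l))%:R / 2 ^+ N = k%:R / 2 ^+ l :> R.
Proof.
move=> lN; rewrite -{2}(subnK lN) exprD natrM natrX.
by field; rewrite !lt0r_neq0 // exprn_gt0.
Qed.

Section Atoms.
Variables (R : realType) (u : R).
Hypothesis u_gt0 : 0 < u.
Let a : R := excursion_mass u.
Variables (P : probability W_infty R) (Q : probability (measurableTypeR R) R).
Hypotheses (hP : is_path_measure u P) (hQ : is_limit_law P Q).

(** The points within 2^-l of [x] lie in three consecutive dyadic intervals of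
    length 2^-l, each of mass at most 1 / (1 + a l).  The bound is obtained as
    a lower bound for the complement of [x], tested on a function that is 1
    at distance at least 2^-l from [x]. *)
Lemma point_mass_le (x : R) (l : nat) : a <= 1 - 2 * a -> 0 <= x ->
  (Q [set x] <= (3 * (1 + a * l%:R)^-1)%:E)%E.
Proof.
move=> ax x0; have [a0 a2] := (excursion_mass_gt0 u_gt0, excursion_mass_lt u_gt0).
have mx : measurable ([set x] : set R) by exact: measurable_set1.
have el0 : 0 < 2 ^+ l :> R by rewrite exprn_gt0.
set j := Num.truncn (x * 2 ^+ l).
(* The interval [(j - 1) / 2^l, (j + 2) / 2^l[ contains the ball of radius
   2^-l about x, up to negative points when j = 0. *)
have /andP[jx xj] : j%:R <= x * 2 ^+ l < j.+1%:R by apply: truncn_itv; rewrite mulr_ge0 // ltW.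
pose f y : R := Num.min 1 (2 ^+ l * `|y - x|).
pose q := 1 - 3 * (1 + a * l%:R)^-1.
suff : (q%:E <= Q (~` [set x]))%E.
  rewrite probability_setC // /q.
  have : Q [set x] \is a fin_num by rewrite fin_num_measure.
  by move=> /fineK <-; rewrite -EFinB !lee_fin; lra.
have t0 y : 0 <= 2 ^+ l * `|y - x| by rewrite mulr_ge0 // ltW.
apply: (limit_law_ge (f := f) (n0 := l) hP hQ).
- apply: min_fun_continuous; first by move=> y; exact: cvg_cst.
  exact: scaled_dist_continuous.
- by move=> y; rewrite /f le_min ler01 t0 ge_min lexx.
- exact: measurableC.
- by move=> y /contrapT ->; rewrite /f subrr normr0 mulr0 min_r.
move=> N lN; exists (~` @band N (j.-1 * 2 ^ (N - l)) (j.+2 * 2 ^ (N - l))); split.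
  rewrite (esum_bandC u_gt0) ?leq_mul2r; last by apply/orP; right; lia.
  rewrite lee_fin /q lerD2l lerN2 !depth_cdf_refine //.
  have g i := depth_cdf_gap a0 a2 l i ax.
  have /andP[_ g1] := g j.+1; have /andP[h2 g2] := g j.
  have g3 : depth_cdf a l j - depth_cdf a l j.-1 <= (1 + a * l%:R)^-1.
    case: (j) h2 g2 => [|i] /= h2 g2; first by rewrite subrr; apply: le_trans g2.
    by have /andP[] := g i.
  by rewrite -/a in g1 g2 g3 *; lra.
move=> c w cA cw; rewrite /f; apply/min_idPl.
have := cA; move/(contra_not (band_scaled_range R _ _ cw).2).
rewrite !dyadic_refine // ler_pdivrMr // ltr_pdivlMr // => /negP.
rewrite negb_and -ltNge -leNgt => out.
rewrite -[2 ^+ l](ger0_norm (ltW el0)) -normrM mulrBr ![2 ^+ l * _]mulrC ler_normr.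
(* When j = 0 the lower bound of the band is 0, and no path is below it. *)
have X0 : 0 <= scaled_range R N w.
  rewrite leNgt; apply/negP => neg.
  have := shallow_scaled_range R 0 cw; rewrite shallow0 mul0r => /esym.
  by rewrite neg.
have {}X0 := mulr_ge0 X0 (ltW el0).
move: jx xj out; move: (_ * _) X0 => X X0; move: (x * _) => y; rewrite -[j.+2%:R]natr1.
case: (j) => [|i] /=; rewrite -?[i.+1%:R]natr1 -?[i.+2%:R]natr1 -?[i.+1%:R]natr1 => jy yj.
  by move=> /orP[] ?; apply/orP; [right|left]; lra.
by move=> /orP[] ?; apply/orP; [right|left]; lra.
Qed.

(** The dyadic interval of length 2^-l that ends at k / 2^m has mass bounded
    below uniformly in l; this mass is captured by closed neighbourhoods that
    shrink to the point. *)
Lemma dyadic_mass_ge (k m : nat) : 1 - 2 * a < a -> (0 < k <= 2 ^ m)%N ->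
  (((1 - (1 - 2 * a) / a) * ((1 - 2 * a) * a) ^+ m)%R%:E <=
    Q [set (k%:R / 2 ^+ m)%R])%E.
Proof.
move=> xa km; have [a0 a2] := (excursion_mass_gt0 u_gt0, excursion_mass_lt u_gt0).
set q := (1 - _) * _; set y : R := k%:R / 2 ^+ m.
(* The radius is twice the length 2^-(m + n) of the dyadic interval, which
   leaves room for a continuous cut-off. *)
pose K (n : nat) : set R := [set z | 2 ^+ (m + n) * `|z - y| <= 2].
have mK n : measurable (K n : set (measurableTypeR R)).
  have mf := continuous_measurable_fun (@scaled_dist_continuous R (2 ^+ (m + n)) y).
  have := mf measurableT _ (measurable_itv `]-oo, 2]); rewrite setTI.
  by congr measurable; apply/seteqP; split=> z; rewrite /= in_itv.
have qK n : (q%:E <= Q (K n))%E.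
  set l := (m + n)%N.
  have el0 : 0 < 2 ^+ l :> R by rewrite exprn_gt0.
  pose f z : R := 1 - Num.min 1 (Num.max 0 (2 ^+ l * `|z - y| - 1)).
  apply: (limit_law_ge (f := f) (n0 := l) hP hQ) => //.
  - move=> z; apply: cvgB; first exact: cvg_cst.
    move: z; apply: min_fun_continuous; first by move=> z; exact: cvg_cst.
    apply: max_fun_continuous; first by move=> z; exact: cvg_cst.
    move=> z; apply: cvgB; last exact: cvg_cst.
    exact: scaled_dist_continuous.
  - move=> z; rewrite /f subr_ge0 ge_min lexx /= gerBl le_min ler01 /=.
    by rewrite le_max lexx.
  - exact: mK.
  - move=> z zK; have {}zK : 2 < 2 ^+ l * `|z - y|.
      by rewrite ltNge; apply/negP => h; exact: zK h.
    rewrite /f min_l ?subrr // le_max; apply/orP; right; lra.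
  move=> N lN; pose i := (k * 2 ^ (l - m))%N.
  have i0 : (0 < i)%N by rewrite muln_gt0 expn_gt0; case/andP: km => ->.
  exists (@band N ((i - 1) * 2 ^ (N - l)) (i * 2 ^ (N - l))); split.
    rewrite esum_band // ?leq_mul2r ?leq_subr ?orbT //.
    rewrite lee_fin !depth_cdf_refine // ?leq_addr //.
    have := depth_cdf_jump a0 a2 xa km (leq_addr n m).
    by rewrite [X in _ <= X - _]depth_cdf_refine ?leq_addr.
  move=> c w cA cw; rewrite /f.
  have /andP[] := (band_scaled_range R _ _ cw).1 cA.
  rewrite (dyadic_refine R (i - 1) lN) (dyadic_refine R i lN).
  rewrite ler_pdivrMr // ltr_pdivlMr // natrB //.
  have -> : i%:R = 2 ^+ l * y.
    by rewrite /i /y natrM natrX -{2}(subnK (leq_addr n m : m <= l)%N) exprD; field;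
      rewrite lt0r_neq0 // exprn_gt0.
  move=> h1 h2; rewrite max_l ?min_r ?subr0 //.
  rewrite subr_le0 -{1}[2 ^+ l](ger0_norm (ltW el0)) -normrM ler_norml; lra.
have -> : [set y] = \bigcap_n K n.
  apply/seteqP; split=> [z -> n _|z zK]; first by rewrite /K /= subrr normr0 mulr0.
  apply/eqP; rewrite -subr_eq0 -normr_eq0 eq_le normr_ge0 andbT leNgt.
  apply/negP => d0; have [n] : exists n : nat, 2 < n%:R * `|z - y|.
    exists (Num.truncn (2 / `|z - y|)).+1.
    by rewrite -ltr_pdivrMr //; exact: truncnS_gt.
  apply/negP; rewrite -leNgt; apply: le_trans (zK n I).
  rewrite ler_pM2r // -natrX ler_nat; apply: ltnW.
  by apply: leq_ltn_trans (leq_addl m n) _; exact: ltn_expl.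
apply: cvge_ge (nonincreasing_cvg_mu _ _ _ _) => //.
- by apply: nearW => n; exact: qK.
- by rewrite (le_lt_trans (probability_le1 _ _)) // ltry.
- exact: bigcap_measurable.
move=> n n' nn'; apply/subsetPset => z; apply: le_trans.
by rewrite ler_wpM2r // ler_eXn2l ?ltr1n // leq_add2l.
Qed.

End Atoms.

(** With a = u^2 x^2 and x = 1 - 2a, the inequality a <= x is equivalent to
    x >= 1/3, and a = x happens exactly for u^2 = 3. *)
Lemma excursion_mass_le (R : realType) (u : R) : 0 < u -> u <= Num.sqrt 3 ->
  excursion_mass u <= 1 - 2 * excursion_mass u.
Proof.
move=> u0 u3; have x0 := x_of_gt0 u; have xE := x_ofE u0.
have u2 : u ^+ 2 <= 3.
  by rewrite -[leRHS](@sqr_sqrtr _ 3) // ler_sqr // ?nnegrE ?sqrtr_ge0 // ltW.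
have aE : excursion_mass u = u ^+ 2 * x_of u ^+ 2 by [].
move: (excursion_mass u) (x_of u) (u ^+ 2) aE xE u2 x0 => a x s aE xE s3 x0.
have ax : a <= 3 * x ^+ 2 by rewrite aE ler_wpM2r // sqr_ge0.
rewrite leNgt; apply/negP => lt_xa.
have : 0 < x * (1 - 3 * x) by rewrite mulr_gt0 //; lra.
by rewrite mulrBr mulr1 mulrCA -expr2; lra.
Qed.

Lemma excursion_mass_gt (R : realType) (u : R) : Num.sqrt 3 < u ->
  1 - 2 * excursion_mass u < excursion_mass u.
Proof.
move=> u3; have u0 : 0 < u := le_lt_trans (sqrtr_ge0 _) u3.
have x0 := x_of_gt0 u; have xE := x_ofE u0.
have u2 : 3 < u ^+ 2.
  by rewrite -[ltLHS](@sqr_sqrtr _ 3) // ltr_sqr // ?nnegrE ?sqrtr_ge0 // ltW.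
have aE : excursion_mass u = u ^+ 2 * x_of u ^+ 2 by [].
move: (excursion_mass u) (x_of u) (u ^+ 2) aE xE u2 x0 => a x s aE xE s3 x0.
have ax : 3 * x ^+ 2 < a by rewrite aE ltr_pM2r // exprn_gt0.
rewrite ltNge; apply/negP => le_ax.
have : 0 <= x * (3 * x - 1) by rewrite mulr_ge0 ?(ltW x0) //; lra.
by rewrite mulrBr mulr1 mulrCA -expr2; lra.
Qed.

Theorem theorem1p4 (R : realType) (u : R)
    (P : probability W_infty R) (Pt : probability (measurableTypeR R) R)
    (hP : is_path_measure u P) (hPt : is_limit_law P Pt) :
  (0 < u <= Num.sqrt 3 -> forall x : R, Pt [set x] = 0%E) /\
  (Num.sqrt 3 < u ->
     forall x : R, dyadic01 x -> 0 < x <= 1 -> (0 < Pt [set x])%E).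
Proof.
split=> [/andP[u0 u3] x|u3 x [_ [k [m xE]]] /andP[x0 x1]].
  have ax := excursion_mass_le u0 u3; have a0 := excursion_mass_gt0 u0.
  have mx : measurable ([set x] : set R) by exact: measurable_set1.
  apply/eqP; rewrite eq_le measure_ge0 andbT.
  have [x0|x0] := leP 0 x; last first.
    have m01 : measurable (`[0, 1]%classic : set R) by exact: measurable_itv.
    have <- : Pt (~` `[0, 1]%classic) = 0%E.
      by rewrite probability_setC // hPt.1 subee.
    apply: le_measure; rewrite ?inE //; first exact: measurableC.
    by move=> z -> /=; rewrite in_itv /= leNgt x0.
  have fx : Pt [set x] \is a fin_num by rewrite fin_num_measure.
  rewrite -(fineK fx) lee_fin leNgt; apply/negP => p0.
  pose t := 3 / (excursion_mass u * fine (Pt [set x])).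
  have := point_mass_le u0 hP hPt (Num.truncn t).+1 ax x0; rewrite /t.
  rewrite -{1}(fineK fx) lee_fin; apply/negP; rewrite -ltNge.
  move: (fine _) p0 => p p0.
  have := truncnS_gt (3 / (excursion_mass u * p)).
  move: (Num.truncn _).+1 => l; rewrite ltr_pdivrMr ?mulr_gt0 // => hl.
  have l0 : 0 <= excursion_mass u * l%:R by rewrite mulr_ge0 // ltW.
  by rewrite ltr_pdivrMr; nra.
have u0 : 0 < u := le_lt_trans (sqrtr_ge0 _) u3.
have xa := excursion_mass_gt u3.
have e0 : 0 < 2 ^+ m :> R by rewrite exprn_gt0.
have k0 : (0 < k)%R by move: x0; rewrite xE pmulr_lgt0 ?invr_gt0 // ltr0z.
have [n kn] : exists n : nat, k = n by exists (absz k); lia.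
have yE : x = n%:R / 2 ^+ m by rewrite xE kn.
have nm : (0 < n <= 2 ^ m)%N.
  apply/andP; split; first by rewrite -ltz_nat -kn.
  by move: x1; rewrite yE ler_pdivrMr // mul1r -natrX ler_nat.
have := dyadic_mass_ge u0 hP hPt xa nm; rewrite -yE; apply: lt_le_trans.
have a0 := excursion_mass_gt0 u0; have a2 := excursion_mass_lt u0.
rewrite lte_fin mulr_gt0 //.
  by rewrite subr_gt0 ltr_pdivrMr // mul1r.
by rewrite exprn_gt0 // mulr_gt0 //; lra.
Qed.
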